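(* There exist universal constants $C_1,C_2,C_3,C_4>0$ such that the following holds for the model $\mathcal M(\delta,\epsilon,\sigma)$ defined in the context, for all $\delta\ge0$, $\sigma>0$ and positive integers $n,m,d,K$. Assume $0\le\epsilon\le\frac12$, $1\le K\le d/C_1$ and $\frac{\sigma+1}{\sigma^2}\frac dn\le C_2$. Then $$\inf_{\{\hat V_i\}}\ \sup_{\mathbb P\in\mathcal M(\delta,\epsilon,\sigma)}\mathbb P\Bigg(\max_{i\in\mathcal S}\|\hat V_i\hat V_i^T-V_iV_i^T\|_F\ge C_3\bigg(\sqrt{\frac{(\sigma+1)Kd}{\sigma^2nm}}+\delta\wedge\sqrt{\frac{(\sigma+1)Kd}{\sigma^2n}}+\epsilon\sqrt{\frac{\sigma+1}{\sigma^2n}}\bigg)\Bigg)\ge C_4,$$ where the infimum is over all collections of estimators $\hat V_i=\hat V_i(X_1,\dots,X_m)\in\mathbb R^{d\times K}$ with orthonormal columns, measurable in the data (the set $\mathcal S$ being unknown to the estimators).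
   Context: Observe $X_1,\dots,X_m$ with $X_i\in\mathbb R^{n\times d}$. For $\delta\ge0$, $0\le\epsilon\le1$, $\sigma>0$, the model $\mathcal M(\delta,\epsilon,\sigma)$ is the set of all joint distributions $\mathbb P$ of $(X_1,\dots,X_m)$ (each taken together with its associated subset $\mathcal S$ and matrices $V_i$, $i\in\mathcal S$) such that: (1) there is a subset $\mathcal S\subseteq[m]=\{1,\dots,m\}$ such that the $X_i$, $i\in\mathcal S$, are independent and, for each $i\in\mathcal S$, the rows of $X_i$ are i.i.d. from $\mathcal N(0,\Sigma_i)$ with $\Sigma_i=\sigma V_iV_i^T+I_d$, where $V_i\in\mathbb R^{d\times K}$ has orthonormal columns; moreover $\max_{i,j\in\mathcal S}\|V_iV_i^T-V_jV_j^T\|_F\le\delta$; (2) $\{X_i\}_{i\in\mathcal S^c}$ follow an arbitrary joint distribution, independent of $\{X_i\}_{i\in\mathcal S}$, and $|\mathcal S^c|\le\epsilon m$. Here $\|\cdot\|_F$ is the Frobenius norm and $a\wedge b=\min(a,b)$. *)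

(* Defs.v *)
From HB Require Import structures.
From mathcomp Require Import all_boot all_order all_algebra.
From mathcomp Require Import all_classical all_reals all_analysis.

Set Implicit Arguments.
Unset Strict Implicit.
Unset Printing Implicit Defensive.

Import Order.TTheory GRing.Theory Num.Theory.
Import numFieldNormedType.Exports.

Local Open Scope classical_set_scope.
Local Open Scope ring_scope.

Section linear_algebra.
Context {R : realType}.

(* The library norm [`|A|] on matrices is the max norm. *)
Definition frobenius_norm (p q : nat) (A : 'M[R]_(p, q)) : R :=
  Num.sqrt (\sum_i \sum_j A i j ^+ 2).

Definition orthonormal_columns (d K : nat) (V : 'M[R]_(d, K)) : Prop :=
  V^T *m V = 1%:M.

Definition proj_dist (d K : nat) (U V : 'M[R]_(d, K)) : R :=
  frobenius_norm (U *m U^T - V *m V^T).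

End linear_algebra.

Section independence.
Context {d d' : measure_display} {T : measurableType d} {T' : measurableType d'}.
Context {R : realType} {I : finType}.

Definition mutually_independent (P : probability T R) (Y : I -> T -> T')
    (D : {set I}) : Prop :=
  forall (J : {set I}) (A : I -> set T'), J \subset D ->
    (forall i, i \in J -> measurable (A i)) ->
    P (\bigcap_(i in [set` J]) (Y i @^-1` A i)) =
      (\prod_(i in J) P (Y i @^-1` A i))%E.

Definition sigma_generated_by (Y : I -> T -> T') (D : {set I}) : set (set T) :=
  <<s \bigcup_(i in [set` D]) preimage_set_system setT (Y i) measurable >>.

Definition independent_subfamilies (P : probability T R) (Y : I -> T -> T')
    (D E : {set I}) : Prop :=
  forall A B : set T,
    sigma_generated_by Y D A -> sigma_generated_by Y E B ->
    P (A `&` B) = (P A * P B)%E.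

End independence.

Section gaussian.
Context {R : realType}.

(* The law N(0, v).  [normal_prob m s] takes the standard deviation [s], and at
   [s = 0] it is the uniform law on [0, 1] instead of the Dirac mass at [m]. *)
Definition centered_normal (v : R) (B : set R) : \bar R :=
  if v == 0 then \d_(0 : R) B else normal_prob 0 (Num.sqrt v) B.

(* A random vector [Y] has law N(0, Sigma) when every linear combination <a, Y>
   of its coordinates has the univariate law N(0, a Sigma a^T). *)
Definition gaussian_vector (dT : measure_display) (T : measurableType dT)
    (P : probability T R) (d : nat) (Y : T -> d.-tuple R) (Sigma : 'M[R]_d)
    : Prop :=
  forall (a : 'rV[R]_d) (B : set R), measurable B ->
    P [set w | B (\sum_k a 0 k * tnth (Y w) k)] =
      centered_normal ((a *m Sigma *m a^T) 0 0) B.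

End gaussian.

Section model.
Variables (R : realType) (n m d K : nat).

(* An n x d observation is the tuple of its n rows; tuples carry the product
   sigma-algebra, so that [sample] has the Borel sigma-algebra of R^(m n d). *)
Definition observation : Type := n.-tuple (d.-tuple R).

Definition sample : Type := m.-tuple observation.

Definition obs (i : 'I_m) (x : sample) : observation := tnth x i.

Definition row_of_obs (i : 'I_m) (j : 'I_n) (x : sample) : d.-tuple R :=
  tnth (obs i x) j.

Definition spiked_cov (sigma : R) (V : 'M[R]_(d, K)) : 'M[R]_d :=
  sigma *: (V *m V^T) + 1%:M.

(* [P] is the joint law of (X_1, ..., X_m), so that X_i is the coordinate map
   [obs i].  The values of [V] outside [S] are irrelevant. *)
Record in_model (delta eps sigma : R) (P : probability sample R)
    (S : {set 'I_m}) (V : 'I_m -> 'M[R]_(d, K)) : Prop := InModel {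
  model_orthonormal : forall i, i \in S -> orthonormal_columns (V i);
  model_indep : mutually_independent P obs S;
  model_rows_indep : forall i, i \in S ->
    mutually_independent P (row_of_obs i) [set: 'I_n]%SET;
  model_rows_gaussian : forall i, i \in S -> forall j : 'I_n,
    gaussian_vector P (row_of_obs i j) (spiked_cov sigma (V i));
  model_close : forall i j, i \in S -> j \in S ->
    proj_dist (V i) (V j) <= delta;
  model_contamination_indep : independent_subfamilies P obs S (~: S)%SET;
  model_contamination_card : #|(~: S)%SET|%:R <= eps * m%:R
}.

Record is_estimator (Vhat : 'I_m -> sample -> 'M[R]_(d, K)) : Prop :=
  IsEstimator {
    estimator_measurable : forall i k l,
      measurable_fun setT (fun x => Vhat i x k l);
    estimator_orthonormal : forall i x, orthonormal_columns (Vhat i x)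
  }.

Definition max_loss (S : {set 'I_m}) (Vhat V : 'I_m -> 'M[R]_(d, K)) : R :=
  \big[Num.max/0]_(i in S) proj_dist (Vhat i) (V i).

Definition worst_case_risk (delta eps sigma t : R)
    (Vhat : 'I_m -> sample -> 'M[R]_(d, K)) : \bar R :=
  ereal_sup [set r | exists (P : probability sample R) (S : {set 'I_m})
                            (V : 'I_m -> 'M[R]_(d, K)),
    in_model delta eps sigma P S V /\
    r = P [set x | t <= max_loss S (fun i => Vhat i x) V]].

Definition minimax_risk (delta eps sigma t : R) : \bar R :=
  ereal_inf (worst_case_risk delta eps sigma t @` is_estimator).

End model.

Arguments minimax_risk {R} n m d K delta eps sigma t.

(* Main.v *)
(* Each of the three terms is a lower bound on its own. A subspace is spanned by
   a frame [c I; s U] with U^T U = I, and the Kullback-Leibler divergence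
   between two spiked Gaussian laws is at most
   (3/2) sigma^2 / (sigma + 1) |V V^T - W W^T|_F^2.
   - First and second term: Fano's method over a packing of matrices U whose
     columns are built from sign vectors. For the first term all the sources
     share the frame; for the second one a single source deviates from the
     others, at distance at most delta.
   - Third term: the two hypotheses U and - U. If P and Q are their laws, there
     are P' and Q' with (1 - e) P + e P' = (1 - e) Q + e Q' for e of the order of
     the square root of the divergence. Contaminating each source independently
     with probability e < eps then makes the two hypotheses indistinguishable,
     and by Markov's inequality at most eps m sources are contaminated with
     large probability. *)
Require Import Defs.
From HB Require Import structures.
From mathcomp Require Import all_boot all_order all_algebra.
From mathcomp Require Import all_classical all_reals all_analysis.
From mathcomp Require Import measurable_realfun zify ring lra.

Set Implicit Arguments.
Unset Strict Implicit.
Unset Printing Implicit Defensive.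

Import Order.TTheory GRing.Theory Num.Theory.
Import numFieldNormedType.Exports.

Local Open Scope ring_scope.

(** * Laws with a density *)

(** The loss sees only the subspace, hence a frame up to rotation. The block [c I] removes this
    ambiguity: the projection has [c s U] as a block, so an estimated subspace gives an estimate of
    [U] linearly, and the distance to the reference frame [s = 0] is [s sqrt (2 K)] whatever [U] is.
    Fano's method appears without entropies. A divergence bound kappa gives P A <= e^l Q A + (kappa
    + 1) / l, and a single observation is close to at most a fraction (3/4)^(K b) of the packing.
    That fraction comes from a generating function of decoding errors, so no well separated
    subfamily has to be selected. The model bounds the number of contaminated sources surely, so a
    randomly contaminated law is not a member of it. It serves only as a mixture over [S], from
    which one admissible [S] is extracted. The rates come from A = (sigma + 1) / (sigma^2 n), the
    inverse of the information that one source carries per unit of squared distance: in each regime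
    [s^2] is the largest multiple of A, up to constants, that the divergence (and [delta])
    allows. *)

Section law.
Local Open Scope classical_set_scope.
Context d d' (T : measurableType d) (T' : measurableType d') (R : realType).
Variables (P : probability T R) (f : T -> T').
Hypothesis mf : measurable_fun setT f.

Definition law : probability T' R :=
  distribution P (HB.pack f (isMeasurableFun.Build _ _ _ _ _ mf) : {mfun T >-> T'}).

Lemma lawE A : law A = P (f @^-1` A).
Proof. by []. Qed.

Lemma integral_law (g : T' -> \bar R) :
  measurable_fun setT g -> (forall y, 0 <= g y)%E ->
  (\int[law]_y g y = \int[P]_x g (f x))%E.
Proof. by move=> mg g0; rewrite ge0_integral_distribution. Qed.

End law.

Section density.
Local Open Scope classical_set_scope.
Local Open Scope ereal_scope.
Context d (T : measurableType d) (R : realType).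
Variables (mu : {measure set T -> \bar R}) (f : T -> R).
Hypothesis mf : measurable_fun setT f.
Hypothesis f0 : forall x, (0 <= f x)%R.

(** The proofs about [f] are arguments so that the measure structure declared below can be inferred
    from the term alone. *)
Definition dens of measurable_fun setT f & (forall x, (0 <= f x)%R) :
  set T -> \bar R := fun A => \int[mu]_(x in A) (f x)%:E.

Local Notation densf := (dens mf f0).

Let dens0 : densf set0 = 0.
Proof. by rewrite /dens integral_set0. Qed.

Let dens_ge0 A : 0 <= densf A.
Proof. by apply: integral_ge0 => x _; rewrite lee_fin. Qed.

Let dens_sigma_additive : semi_sigma_additive densf.
Proof.
move=> F mF tF mU; rewrite /dens ge0_integral_bigcup//.
- apply: is_cvg_ereal_nneg_natsum_cond => n _ _.
  by apply: integral_ge0 => x _; rewrite lee_fin.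
- by apply/measurable_EFinP; exact: measurable_funTS.
- by move=> x _; rewrite lee_fin.
Qed.

HB.instance Definition _ :=
  isMeasure.Build _ _ _ densf dens0 dens_ge0 dens_sigma_additive.

Definition density_prob (f1 : \int[mu]_x (f x)%:E = 1) : probability T R :=
  HB.pack densf (Measure_isProbability.Build _ _ _ densf f1).

Lemma density_probE f1 A :
  density_prob f1 A = \int[mu]_(x in A) (f x)%:E.
Proof. by []. Qed.

End density.

Section integral_density.
Local Open Scope classical_set_scope.
Local Open Scope ereal_scope.
Context d (T : measurableType d) (R : realType).
Variables (mu : {measure set T -> \bar R}) (P : {measure set T -> \bar R}) (f : T -> R).
Hypothesis mf : measurable_fun setT f.
Hypothesis f0 : forall x, (0 <= f x)%R.
Hypothesis Pf : forall A, measurable A -> P A = \int[mu]_(x in A) (f x)%:E.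

Import HBNNSimple.

(** Both sides commute with increasing limits of simple functions, which reduces the claim to
    indicators of level sets, where it is [Pf]. *)
Lemma integral_density (g : T -> \bar R) :
  measurable_fun setT g -> (forall y, 0 <= g y) ->
  \int[P]_y g y = \int[mu]_x (g x * (f x)%:E).
Proof.
move=> mg g0.
pose g_ := nnsfun_approx measurableT mg.
have gE x : g x = limn (fun n => (g_ n x)%:E).
  by apply/esym/cvg_lim => //; apply: cvg_nnsfun_approx.
have ndg x : {homo (fun n => (g_ n x)%:E) : a b / (a <= b)%N >-> a <= b}.
  by move=> a b ab; rewrite lee_fin; exact/lefP/nd_nnsfun_approx.
have mg_ n : measurable_fun setT (fun x => (g_ n x)%:E).
  exact/measurable_EFinP/measurable_funP.
have gf0 n x : setT x -> 0 <= (g_ n x)%:E by rewrite lee_fin.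
have ndgf x : {homo (fun n => (f x)%:E * (g_ n x)%:E) : a b / (a <= b)%N >-> a <= b}.
  by move=> a b ab; rewrite lee_wpmul2l ?lee_fin//; exact/lefP/nd_nnsfun_approx.
under eq_integral do rewrite gE.
rewrite (monotone_convergence _ _ mg_ gf0)//.
under [in RHS]eq_integral => x _.
  rewrite gE muleC -limeMl//; last first.
    by apply: ereal_nondecreasing_is_cvgn => a b ab; exact: ndg.
  over.
have mgf n : measurable_fun setT (fun x => (f x)%:E * (g_ n x)%:E).
  by apply: emeasurable_funM => //; exact/measurable_EFinP.
rewrite (monotone_convergence _ _ mgf)//; last first.
  by move=> n y _; rewrite mule_ge0// lee_fin.
apply: congr_lim; apply/funext => n.
under eq_integral do rewrite fimfunE -fsumEFin//.
rewrite ge0_integral_fsum//; last 2 first.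
- by move=> r; exact/measurable_EFinP/measurable_funM.
- by move=> r x _; rewrite EFinM nnfun_muleindic_ge0.
transitivity (\int[mu]_x (\sum_(r \in range (g_ n))
    ((f x)%:E * (r * \1_(g_ n @^-1` [set r]) x)%:E))); last first.
  apply: eq_integral => x _.
  rewrite [in RHS]fimfunE -fsumEFin// ge0_mule_fsumr// => r.
  by rewrite EFinM nnfun_muleindic_ge0.
rewrite ge0_integral_fsum//; last 2 first.
- move=> r; apply: emeasurable_funM; first exact/measurable_EFinP.
  exact/measurable_EFinP/measurable_funM.
- by move=> r x _; apply: mule_ge0; [rewrite lee_fin|rewrite EFinM nnfun_muleindic_ge0].
apply: eq_fsbigr => r rg.
rewrite integralZl_indic_nnsfun// integral_indic//= setIT Pf//.
have r0 : (0 <= r)%R by move: rg; rewrite inE => -[x _ <-].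
under [in RHS]eq_integral do rewrite EFinM muleCA.
rewrite ge0_integralZl//; last 2 first.
- apply: emeasurable_funM; first exact/measurable_EFinP.
  exact/measurable_EFinP/measurable_indic.
- by move=> x _; rewrite mule_ge0 ?lee_fin.
congr (_ * _); rewrite integral_mkcond; apply: eq_integral => x _.
by rewrite patchE indicE; case: ifP => _; rewrite ?mule1 ?mule0.
Qed.

End integral_density.

(** * Finite products of probabilities *)

Section integral_indic_setT.
Local Open Scope classical_set_scope.
Context d (T : measurableType d) (R : realType).

Lemma integral_indic_setT (mu : {measure set T -> \bar R}) (A : set T) :
  measurable A -> (\int[mu]_x (\1_A x)%:E = mu A)%E.
Proof. by move=> mA; rewrite integral_indic// setIT. Qed.

End integral_indic_setT.

Section box.
Local Open Scope classical_set_scope.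
Context d (T : measurableType d) (R : realType) (n : nat).

Definition box (A : 'I_n -> set T) : set (n.-tuple T) :=
  [set x | forall i, A i (tnth x i)].

Lemma measurable_box A : (forall i, measurable (A i)) -> measurable (box A).
Proof.
move=> mA.
have -> : box A = \big[setI/setT]_(i < n) (fun x => tnth x i) @^-1` A i.
  apply/seteqP; split => x /=.
    by move=> Ax; rewrite -bigcap_seq => i _ /=; exact: Ax.
  by rewrite -bigcap_seq => Ax i; apply: (Ax i); rewrite /= mem_index_enum.
apply: bigsetI_measurable => i _; rewrite -[X in measurable X]setTI.
exact: measurable_tnth.
Qed.

(** Boxes form a pi-system that generates the product sigma-algebra and contains the whole space.
    Every identity between laws of tuples below is checked on boxes through this lemma. *)
Lemma tuple_measure_unique (m1 m2 : {measure set (n.-tuple T) -> \bar R}) :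
  (m1 setT < +oo)%E ->
  (forall A, (forall i, measurable (A i)) -> m1 (box A) = m2 (box A)) ->
  forall B, measurable B -> m1 B = m2 B.
Proof.
move=> m1oo m12 B mB.
have boxT : box (fun _ => setT) = setT by apply/seteqP; split.
apply: (measure_unique [set box A | A in [set A | forall i, measurable (A i)]]
  (fun _ => setT)) => //.
- apply/seteqP; split.
    apply: smallest_sub; first exact: smallest_sigma_algebra.
    move=> A; rewrite -bigcup_seq => -[i _ [C mC <-]]; apply: sub_sigma_algebra.
    exists (fun j => if j == i then C else setT) => [j|].
      by case: ifP.
    rewrite setTI; apply/seteqP; split=> x /= h.
      by have := h i; rewrite eqxx.
    by move=> j; case: eqP => // ->.
  apply: smallest_sub; first exact: sigma_algebra_measurable.
  by move=> _ [A mA <-]; exact: measurable_box.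
- move=> _ _ [A mA <-] [C mC <-]; exists (fun i => A i `&` C i).
    by move=> i; exact: measurableI.
  by apply/seteqP; split=> x /= h; [split=> i; have [] := h i|move=> i; split; apply h].
- by move=> _; exists (fun _ => setT).
- by rewrite bigcup_const //; exists 0%N.
- by move=> _ [A mA <-]; exact: m12.
Qed.

End box.

Section tprod.
Local Open Scope classical_set_scope.
Context d (T : measurableType d) (R : realType).

Definition tcons n (x : T * n.-tuple T) : n.+1.-tuple T := [tuple of x.1 :: x.2].

Lemma measurable_tcons n : measurable_fun setT (@tcons n).
Proof. exact: measurable_cons. Qed.

Fixpoint tprod n : ('I_n -> probability T R) -> probability (n.-tuple T) R :=
  match n with
  | 0 => fun _ => \d_[tuple]
  | n'.+1 => fun mu =>
      law (mu ord0 \x tprod (fun i => mu (lift ord0 i)))%E (@measurable_tcons n')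
  end.

Lemma measurable_tprod_fun n (g : 'I_n -> T -> \bar R) :
  (forall i, measurable_fun setT (g i)) ->
  measurable_fun setT (fun x : n.-tuple T => \prod_(i < n) g i (tnth x i))%E.
Proof.
move=> mg; rewrite unlock; elim: (index_enum _) => [|i s IH] /=.
  exact: measurable_cst.
apply: emeasurable_funM => //.
by apply: measurableT_comp => //; exact: measurable_tnth.
Qed.

Lemma integral_tprod n (mu : 'I_n -> probability T R) (g : 'I_n -> T -> \bar R) :
  (forall i, measurable_fun setT (g i)) -> (forall i x, 0 <= g i x)%E ->
  (\int[tprod mu]_x \prod_(i < n) g i (tnth x i) =
   \prod_(i < n) \int[mu i]_x g i x)%E.
Proof.
elim: n => [|n IH] in mu g *; move=> mg g0.
  under eq_integral do rewrite big_ord0.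
  by rewrite big_ord0 integral_cst ?mul1e//; exact: probability_setT.
have mG := measurable_tprod_fun mg.
have G0 m (h : 'I_m -> T -> \bar R) : (forall i x, 0 <= h i x)%E ->
    forall x : m.-tuple T, (0 <= \prod_(i < m) h i (tnth x i))%E.
  by move=> h0 x; apply: prode_ge0.
have mC := measurableT_comp mG (@measurable_tcons n).
rewrite /= (integral_law _ _ mG); last exact: G0.
rewrite (fubini_tonelli1 _ mC)/=; last by move=> y; exact: G0.
rewrite big_ord_recl -IH//.
have gE x (y : n.-tuple T) : (\prod_(i < n.+1) g i (tnth (tcons (x, y)) i) =
    g ord0 x * \prod_(i < n) g (lift ord0 i) (tnth y i))%E.
  by rewrite big_ord_recl; congr (_ * _)%E; apply: eq_bigr => i _; rewrite tnthS.
transitivity (\int[mu ord0]_x \int[tprod (fun i => mu (lift ord0 i))]_y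
    (g ord0 x * \prod_(i < n) g (lift ord0 i) (tnth y i)))%E.
  by apply: eq_integral => x _; apply: eq_integral => y _; exact: gE.
under eq_integral.
  move=> x _; rewrite ge0_integralZl//; last 2 first.
  - exact: (@measurable_tprod_fun n (fun i => g (lift ord0 i))).
  - by move=> y _; apply: (@G0 n (fun i => g (lift ord0 i))) => *.
over.
rewrite ge0_integralZr//.
by apply: integral_ge0 => y _; apply: (@G0 n (fun i => g (lift ord0 i))) => *.
Qed.

Lemma tprod_box n (mu : 'I_n -> probability T R) A :
  (forall i, measurable (A i)) ->
  tprod mu (box A) = (\prod_(i < n) mu i (A i))%E.
Proof.
move=> mA.
have mI i : measurable_fun setT (fun x => (\1_(A i) x)%:E : \bar R).
  exact/measurable_EFinP/measurable_indic.
rewrite -[LHS]integral_indic_setT; last exact: measurable_box.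
transitivity (\int[tprod mu]_x \prod_(i < n) (\1_(A i) (tnth x i))%:E)%E.
  apply: eq_integral => x _; rewrite indicE.
  have [Ax|nAx] := pselect (forall i, A i (tnth x i)).
    rewrite mem_set//= big1// => i _; rewrite indicE mem_set//.
  rewrite memNset//=; have [i nAi] := (existsNP _).2 nAx.
  rewrite (bigD1 i)//= indicE memNset// mul0e//.
rewrite (integral_tprod mu mI)//.
by apply: eq_bigr => i _; exact: integral_indic_setT.
Qed.

Lemma tprod_preimage n (mu : 'I_n -> probability T R) i A : measurable A ->
  tprod mu ((fun x => tnth x i) @^-1` A) = mu i A.
Proof.
move=> mA; have -> : (fun x : n.-tuple T => tnth x i) @^-1` A =
    box (fun j => if j == i then A else setT).
  apply/seteqP; split => x /= h; first by move=> j; case: eqP => // ->.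
  by have := h i; rewrite eqxx.
rewrite tprod_box; last by move=> j; case: ifP.
rewrite (bigD1 i)//= eqxx big1 ?mule1// => j /negbTE ->.
exact: probability_setT.
Qed.

Lemma integral_tprod_tnth n (mu : 'I_n -> probability T R) i (g : T -> \bar R) :
  measurable_fun setT g -> (forall x, 0 <= g x)%E ->
  (\int[tprod mu]_x g (tnth x i) = \int[mu i]_x g x)%E.
Proof.
move=> mg g0; rewrite -(integral_law (tprod mu) (measurable_tnth i))//.
by apply: eq_measure_integral => A mA _; exact: tprod_preimage.
Qed.

Lemma tprod_density n (mu nu : 'I_n -> probability T R) (f : 'I_n -> T -> R) :
  (forall i, measurable_fun setT (f i)) -> (forall i x, 0 <= f i x) ->
  (forall i A, measurable A -> nu i A = \int[mu i]_(x in A) (f i x)%:E)%E ->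
  forall B, measurable B ->
  (tprod nu B = \int[tprod mu]_(x in B) (\prod_(i < n) f i (tnth x i))%:E)%E.
Proof.
move=> mf f0 nuE.
have mF : measurable_fun setT (fun x : n.-tuple T => \prod_(i < n) f i (tnth x i)).
  apply: measurable_prod => i _.
  by apply: measurableT_comp => //; exact: measurable_tnth.
have F0 (x : n.-tuple T) : 0 <= \prod_(i < n) f i (tnth x i) by apply: prodr_ge0.
(* Reading the right-hand side as a measure in [B] lets uniqueness on boxes apply. *)
move=> B; rewrite -[RHS]/(dens (tprod mu) mF F0 B).
apply: tuple_measure_unique.
  by apply: (@le_lt_trans _ _ 1%E); [exact: probability_le1|exact: ltry].
move=> A mA.
apply: (@eq_trans _ _ (\prod_(i < n) nu i (A i))%E); first exact: tprod_box.
apply: (@eq_trans _ _ (\int[tprod mu]_(x in box A)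
  (\prod_(i < n) f i (tnth x i))%:E)%E); last by [].
rewrite [RHS]integral_mkcond -[RHS](_ : (\int[tprod mu]_x \prod_(i < n)
    (fun i x => (f i x * \1_(A i) x)%:E) i (tnth x i))%E = _); last first.
  apply: eq_integral => x _; rewrite patchE.
  rewrite prodEFin.
  have [Ax|nAx] := pselect (forall i, A i (tnth x i)).
    rewrite mem_set//=; congr EFin; apply: eq_bigr => i _.
    by rewrite indicE mem_set// mulr1.
  rewrite memNset//=; have [i nAi] := (existsNP _).2 nAx.
  by rewrite (bigD1 i)//= indicE memNset// mulr0 mul0r.
have mI i : measurable_fun setT (fun x => (f i x * \1_(A i) x)%:E).
  exact/measurable_EFinP/measurable_funM.
rewrite (integral_tprod mu mI); last first.
  by move=> i x; rewrite lee_fin mulr_ge0.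
apply: eq_bigr => i _; rewrite nuE// integral_mkcond.
apply: eq_integral => x _; rewrite patchE indicE.
by case: ifP; rewrite ?mulr1 ?mulr0.
Qed.

End tprod.

Section independence.
Local Open Scope classical_set_scope.
Context d (T : measurableType d) (R : realType) (n : nat).
Variable mu : 'I_n -> probability T R.

Lemma tprod_bigcap (J : {set 'I_n}) (A : 'I_n -> set T) :
  (forall i, i \in J -> measurable (A i)) ->
  tprod mu (\bigcap_(i in [set` J]) ((fun x => tnth x i) @^-1` A i)) =
    (\prod_(i in J) mu i (A i))%E.
Proof.
move=> mA; pose B i := if i \in J then A i else setT.
have mB i : measurable (B i) by rewrite /B; case: ifPn => // iJ; exact: mA.
have -> : \bigcap_(i in [set` J]) ((fun x : n.-tuple T => tnth x i) @^-1` A i)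
    = box B.
  apply/seteqP; split=> x /= h i.
    by rewrite /B; case: ifPn => // iJ; exact: h.
  by move=> /= iJ; have := h i; rewrite /B iJ.
rewrite tprod_box// [RHS]big_mkcond; apply: eq_bigr => i _.
by rewrite /B; case: ifP => // _; exact: probability_setT.
Qed.

Lemma tprod_mutually_independent (D : {set 'I_n}) :
  mutually_independent (tprod mu) (fun i x => tnth x i) D.
Proof.
move=> J A JD mA; rewrite tprod_bigcap//; apply: eq_bigr => i iJ.
by rewrite tprod_preimage//; exact: mA.
Qed.

Variable D : {set 'I_n}.

(** Applied to two independent copies of a sample, splicing preserves its law while making the
    coordinates in [D] and those outside [D] functions of different copies. Independence of
    subfamilies follows from this. *)
Definition splice (x : n.-tuple T * n.-tuple T) : n.-tuple T :=
  [tuple (if i \in D then tnth x.1 i else tnth x.2 i) | i < n].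

Lemma measurable_splice : measurable_fun setT splice.
Proof.
apply/measurable_fun_tnthP => i.
rewrite (_ : _ \o _ = fun x => if i \in D then tnth x.1 i else tnth x.2 i); last first.
  by apply/funext => x; rewrite /= tnth_mktuple.
by case: (i \in D); apply: (@measurableT_comp _ _ _ _ _ _ (fun x => tnth x i)) => //;
  exact: measurable_tnth.
Qed.

Lemma law_splice A : measurable A ->
  ((tprod mu \x tprod mu) (splice @^-1` A) = tprod mu A)%E.
Proof.
move=> mA; rewrite -[LHS]/(law (tprod mu \x tprod mu)%E measurable_splice A).
apply: tuple_measure_unique => //.
  by apply: (@le_lt_trans _ _ 1%E); [exact: probability_le1|exact: ltry].
move=> B mB.
pose B1 i := if i \in D then B i else setT.
pose B2 i := if i \in D then setT else B i.
have mB1 i : measurable (B1 i) by rewrite /B1; case: ifP.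
have mB2 i : measurable (B2 i) by rewrite /B2; case: ifP.
apply: (@eq_trans _ _ ((tprod mu \x tprod mu) (box B1 `*` box B2))%E).
  rewrite [LHS]lawE; congr (_ _); apply/seteqP; split => [[x y] /= h|[x y] [/= h1 h2] i].
    by split => i /=; have := h i; rewrite tnth_mktuple /B1 /B2; case: ifP.
  rewrite tnth_mktuple; have := h1 i; have := h2 i.
  by rewrite /B1 /B2; case: ifP.
rewrite product_measure1E ?(tprod_box mu mB1) ?(tprod_box mu mB2)//; last 2 first.
- exact: measurable_box.
- exact: measurable_box.
apply: (@eq_trans _ _ (\prod_(i < n) mu i (B i))%E); last first.
  by apply/esym; exact: tprod_box.
transitivity ((\prod_(i < n) mu i (B1 i)) * (\prod_(i < n) mu i (B2 i)))%E.
  by congr (_ * _)%E; exact: tprod_box.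
rewrite -big_split/=; apply: eq_bigr => i _; rewrite /B1 /B2.
have muT : mu i setT = 1%E by exact: probability_setT.
by case: (i \in D); rewrite muT ?mule1 ?mul1e.
Qed.

(** The measurable sets that cannot separate points agreeing on [E] form a sigma-algebra containing
    the generators. *)
Lemma sigma_generated_by_tuple (E : {set 'I_n}) (A : set (n.-tuple T)) :
  sigma_generated_by (fun i x => tnth x i) E A ->
  measurable A /\
  forall x y, (forall i, i \in E -> tnth x i = tnth y i) -> A x -> A y.
Proof.
pose G := [set A : set (n.-tuple T) | measurable A /\
  forall x y, (forall i, i \in E -> tnth x i = tnth y i) -> A x -> A y].
apply: (@smallest_sub _ (sigma_algebra setT) _ G).
- split.
  + by split => // x y.
  + move=> B [mB hB]; split; first by rewrite setTD; exact: measurableC.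
    move=> x y xy /= [_ nBx]; split => // By; apply: nBx; apply: hB By => i iE.
    by rewrite xy.
  + move=> F hF; split; first by apply: bigcup_measurable => k _; have [] := hF k.
    by move=> x y xy [k _ Fx]; exists k => //; have [_ h] := hF k; exact: h Fx.
- move=> _ [i iE [C mC <-]]; split.
    exact: (measurable_tnth i).
  by move=> x y xy /= [_ Cx]; split => //; rewrite /= -xy.
Qed.

Lemma tprod_independent_subfamilies (E : {set 'I_n}) :
  (forall i, i \in E -> i \notin D) ->
  independent_subfamilies (tprod mu) (fun i x => tnth x i) D E.
Proof.
move=> DE A B /sigma_generated_by_tuple[mA hA] /sigma_generated_by_tuple[mB hB].
(* After splicing, [A] looks only at the first copy and [B] only at the second, so the preimage of
   the intersection is the rectangle on [A] and [B]. *)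
rewrite -[LHS]law_splice; last exact: measurableI.
rewrite -product_measure1E//; congr (_ _).
apply/seteqP; split => [[x y] /= [h1 h2]|[x y] /= [h1 h2]]; split.
- by apply: hA h1 => i iD; rewrite tnth_mktuple iD.
- apply: hB h2 => i iE; rewrite tnth_mktuple; case: ifPn => // iD.
  by have := DE _ iE; rewrite iD.
- by apply: hA h1 => i iD; rewrite tnth_mktuple iD.
- apply: hB h2 => i iE; rewrite tnth_mktuple; case: ifPn => // iD.
  by have := DE _ iE; rewrite iD.
Qed.

End independence.

(** * Gaussian laws *)

Section lebesgue_affine.
Local Open Scope classical_set_scope.
Local Open Scope ereal_scope.
Context {R : realType}.
Local Notation leb := (@lebesgue_measure R).

Lemma measurable_affine (c h : R) : measurable_fun setT (fun x : R => c * x + h)%R.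
Proof. by apply: measurable_funD => //; exact: measurable_funM. Qed.

Lemma integral_affine (c h : R) (g : R -> \bar R) : (0 < c)%R ->
  measurable_fun setT g -> (forall x, 0 <= g x) ->
  \int[leb]_x g (c * x + h)%R = (c^-1)%:E * \int[leb]_x g x.
Proof.
move=> c0 mg g0.
pose F (x : measurableTypeR R) : measurableTypeR R := (c * x + h)%R.
have mF : measurable_fun setT F by exact: measurable_affine.
have cE (A : set (measurableTypeR R)) : measurable A -> leb (F @^-1` A) = (c^-1)%:E * leb A.
  move=> mA; pose nu := mscale (NngNum (ltW c0)) (pushforward leb F).
  have -> : leb A = nu mF A.
    apply: lebesgue_measure_unique => // _ [[a b]] _ <-.
    apply: (@eq_trans _ _ (c%:E * leb (F @^-1` `]a, b]))); last by [].
    have -> : F @^-1` `]a, b] = `]((a - h) / c)%R, ((b - h) / c)%R]%classic.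
      apply/seteqP; split => x /=; rewrite !in_itv/= /F.
        by move=> /andP[h1 h2]; rewrite ltr_pdivrMr// ler_pdivlMr// ltrBlDr lerBrDr mulrC h1 h2.
      by rewrite ltr_pdivrMr// ler_pdivlMr// ltrBlDr lerBrDr mulrC => /andP[h1 h2]; rewrite h1 h2.
    rewrite !lebesgue_measure_itv/= !lte_fin ltr_pM2r ?invr_gt0// ltrD2r.
    case: ifP => _; last by rewrite mule0.
    rewrite -!EFinB -EFinM; congr EFin; field; lra.
  by rewrite /nu /mscale/= /pushforward muleA -EFinM mulVf ?mul1e// gt_eqF.
have ci0 : (0 <= c^-1)%R by rewrite invr_ge0 ltW.
transitivity (\int[mscale (NngNum ci0) leb]_x g x); last by rewrite ge0_integral_mscale.
transitivity (\int[pushforward leb F]_x g x).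
  by rewrite ge0_integral_pushforward.
by apply: eq_measure_integral => A mA _; exact: cE.
Qed.

End lebesgue_affine.

Section normal.
Local Open Scope classical_set_scope.
Context {R : realType}.
Local Notation leb := (@lebesgue_measure R).

Lemma measurable_idR :
  measurable_fun setT (fun x : measurableTypeR R => x : R).
Proof. by move=> _ A mA; rewrite setTI. Qed.

(* [normal_prob] lives on [measurableTypeR R], whose display differs from the
   one of [R]. *)
Definition normal (m s : R) : probability R R := law (normal_prob m s) measurable_idR.

Definition std : probability R R := normal 0 1.

Lemma integral_normal (m s : R) (g : R -> \bar R) :
  measurable_fun setT g -> (forall x, 0 <= g x)%E ->
  (\int[normal m s]_x g x = \int[leb]_x (g x * (normal_pdf m s x)%:E))%E.
Proof.
move=> mg g0; rewrite integral_law//; apply: integral_density => //.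
- exact: measurable_normal_pdf.
- exact: normal_pdf_ge0.
Qed.

(** The constant is isolated as [normal_peak 1], so that it cancels whenever two densities are
    compared and only exponents remain. *)
Lemma normal_pdf_gt0E (m s x : R) : 0 < s -> normal_pdf m s x =
  s^-1 * normal_peak 1 * expR (- (x - m) ^+ 2 / (2 * s ^+ 2)).
Proof.
move=> s0; rewrite normal_pdfE ?gt_eqF// /normal_fun -[s ^+ 2 *+ 2]mulr_natl.
congr (_ * _); rewrite /normal_peak expr1n mul1r -mulrnAr sqrtrM ?sqr_ge0//.
by rewrite sqrtr_sqr gtr0_norm// invfM.
Qed.

Lemma integral_normal_affine (m s : R) (g : R -> \bar R) : 0 < s ->
  measurable_fun setT g -> (forall x, 0 <= g x)%E ->
  (\int[std]_x g (s * x + m)%R = \int[normal m s]_x g x)%E.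
Proof.
move=> s0 mg g0; have ma := measurable_affine s m.
have mga : measurable_fun setT (fun x : R => g (s * x + m)) by exact: measurableT_comp.
rewrite [RHS](integral_normal _ _ mg g0) (integral_normal 0 1 mga (fun=> g0 _)).
pose G y := (g y * (normal_pdf m s y)%:E)%E.
have mG : measurable_fun setT G.
  by apply: emeasurable_funM => //; apply/measurable_EFinP; exact: measurable_normal_pdf.
have G0 y : (0 <= G y)%E by rewrite mule_ge0// lee_fin normal_pdf_ge0.
have E : (\int[leb]_x G x = s%:E * \int[leb]_x G (s * x + m)%R)%E.
  by rewrite integral_affine// muleA -EFinM mulfV ?gt_eqF// mul1e.
apply: (@eq_trans _ _ (\int[leb]_x G x)%E); last by [].
apply: (@eq_trans _ _ (s%:E * \int[leb]_x G (s * x + m)%R)%E); last exact/esym.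
rewrite -ge0_integralZl//; last 2 first.
- exact: (measurableT_comp mG ma).
- by rewrite lee_fin ltW.
apply: eq_integral => x _; rewrite /G muleCA -EFinM; congr (_ * _%:E)%E.
rewrite !normal_pdf_gt0E// subr0 addrK invr1 mul1r expr1n mulr1.
rewrite !mulrA mulfV ?gt_eqF// mul1r; congr (_ * expR _).
by field; rewrite gt_eqF.
Qed.

Lemma integral_stdN (g : R -> \bar R) :
  measurable_fun setT g -> (forall x, 0 <= g x)%E ->
  (\int[std]_x g (- x)%R = \int[std]_x g x)%E.
Proof.
move=> mg g0; have mN : measurable_fun setT (-%R : R -> R) by [].
have mga : measurable_fun setT (fun x : R => g (- x)) by exact: measurableT_comp.
rewrite [RHS](integral_normal _ _ mg g0) (integral_normal 0 1 mga (fun=> g0 _)).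
pose G y := (g y * (normal_pdf 0 1 y)%:E)%E.
have mG : measurable_fun setT G.
  by apply: emeasurable_funM => //; apply/measurable_EFinP; exact: measurable_normal_pdf.
have G0 y : (0 <= G y)%E by rewrite mule_ge0// lee_fin normal_pdf_ge0.
transitivity (\int[pushforward leb (-%R : _ -> measurableTypeR R)]_x G x)%E.
  rewrite ge0_integral_pushforward; [|exact: mN|exact: measurableT|exact: mG|].
    apply: eq_integral => x _; rewrite /G /comp; congr (_ * _%:E)%E.
    by rewrite !normal_pdf_gt0E ?ltr01 // !subr0 sqrrN.
  by move=> y _; exact: G0.
by apply: eq_measure_integral => A mA _; exact: lebesgue_measureN.
Qed.

(** The one-dimensional Cameron-Martin formula. It yields both the convolution of Gaussian laws and
    the density of the spiked law. *)
Lemma integral_std_shift (h : R) (g : R -> \bar R) :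
  measurable_fun setT g -> (forall x, 0 <= g x)%E ->
  (\int[std]_x g (x + h)%R =
   \int[std]_x (g x * (expR (h * x - h ^+ 2 / 2))%:E))%E.
Proof.
move=> mg g0.
transitivity (\int[normal h 1]_x g x)%E.
  by rewrite -integral_normal_affine//; apply: eq_integral => x _; rewrite mul1r.
rewrite [LHS]integral_normal// [RHS]integral_normal; last 2 first.
- apply: emeasurable_funM => //; apply/measurable_EFinP.
  by apply: measurableT_comp => //; exact: measurable_affine.
- by move=> x; rewrite mule_ge0// lee_fin expR_ge0.
apply: eq_integral => x _; rewrite -muleA -EFinM; congr (_ * _%:E)%E.
rewrite !normal_pdf_gt0E ?ltr01// [RHS]mulrCA -expRD; congr (_ * expR _).
by field.
Qed.

(** Completing the square: against the standard density, the integrand is a multiple of the normal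
    density with mean a / (1 + s) and variance 1 / (1 + s). *)
Lemma integral_std_expquad (a s : R) : 0 < 1 + s ->
  (\int[std]_x (expR (a * x - s * x ^+ 2 / 2))%:E =
   ((Num.sqrt (1 + s))^-1 * expR (a ^+ 2 / (2 * (1 + s))))%:E)%E.
Proof.
move=> s0; set r := Num.sqrt (1 + s).
have r0 : 0 < r by rewrite sqrtr_gt0.
have r2 : r ^+ 2 = 1 + s by rewrite sqr_sqrtr// ltW.
have mf : measurable_fun setT (fun x : R => (expR (a * x - s * x ^+ 2 / 2))%:E).
  apply/measurable_EFinP; apply: measurableT_comp => //; apply: measurable_funB => //.
  apply: measurable_funM => //; apply: measurable_funM => //.
rewrite [LHS]integral_normal//.
pose c := (r^-1 * expR (a ^+ 2 / (2 * (1 + s)))).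
have c0 : 0 <= c by rewrite mulr_ge0 ?expR_ge0// invr_ge0 ltW.
transitivity (\int[leb]_x (c%:E * (normal_pdf (a / (1 + s)) r^-1 x)%:E))%E.
  apply: eq_integral => x _; rewrite -!EFinM; congr EFin.
  rewrite !normal_pdf_gt0E ?invr_gt0// invrK invr1 mul1r subr0 expr1n mulr1.
  rewrite /c [RHS]mulrACA mulKf ?gt_eqF// [LHS]mulrCA -!expRD.
  congr (_ * expR _); rewrite exprVn r2; field; rewrite gt_eqF//.
rewrite ge0_integralZl//; last 2 first.
- by apply/measurable_EFinP; exact: measurable_normal_pdf.
- by move=> x _; rewrite lee_fin normal_pdf_ge0.
by rewrite integral_normal_pdf mule1.
Qed.

End normal.

Section convolution.
Local Open Scope classical_set_scope.
Context {R : realType}.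
Local Notation std := (@std R).

(** The shift formula turns the translation by [c z] into an exponential weight; after the integrals
    are exchanged, the weight is a Gaussian integral in [z], and what is left is the density of N(0,
    1 + c^2). *)
Lemma std_conv1 (c : R) (g : R -> \bar R) :
  measurable_fun setT g -> (forall x, 0 <= g x)%E ->
  (\int[std]_z \int[std]_w g (c * z + w)%R =
   \int[std]_x g (Num.sqrt (1 + c ^+ 2) * x)%R)%E.
Proof.
move=> mg g0; set r := Num.sqrt _.
have c1 : 0 < 1 + c ^+ 2 by rewrite ltr_wpDr ?sqr_ge0.
have r0 : 0 < r by rewrite sqrtr_gt0.
have r2 : r ^+ 2 = 1 + c ^+ 2 by rewrite sqr_sqrtr// ltW.
pose F (x : R * R) := (g x.2 * (expR (c * x.1 * x.2 - (c * x.1) ^+ 2 / 2))%:E)%E.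
have mF : measurable_fun setT F.
  apply: emeasurable_funM; first exact: measurableT_comp.
  apply/measurable_EFinP; apply: measurableT_comp => //; apply: measurable_funB => //.
    by do 2 apply: measurable_funM => //.
  by apply: measurable_funM => //; apply: measurable_funX; apply: measurable_funM.
have F0 x : (0 <= F x)%E by rewrite mule_ge0// lee_fin expR_ge0.
transitivity (\int[std]_z \int[std]_w F (z, w))%E.
  apply: eq_integral => z _.
  apply: (@eq_trans _ _ (\int[std]_w g (w + c * z)%R)%E).
    by apply: eq_integral => w _; rewrite addrC.
  exact: (integral_std_shift (c * z) mg g0).
rewrite (fubini_tonelli F mF F0).
transitivity (\int[std]_w (g w * (r^-1 * expR (c ^+ 2 * w ^+ 2 / (2 * (1 + c ^+ 2))))%:E))%E.
  apply: eq_integral => w _; rewrite /F/=.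
  have mE : measurable_fun setT (fun x : R => (expR (c * x * w - (c * x) ^+ 2 / 2))%:E).
    apply/measurable_EFinP; apply: measurableT_comp => //; apply: measurable_funB.
      by do 2 apply: measurable_funM => //.
    by apply: measurable_funM => //; apply: measurable_funX; apply: measurable_funM.
  rewrite ge0_integralZl; [|exact: measurableT|exact: mE| |exact: g0]; last first.
    by move=> x _; rewrite lee_fin expR_ge0.
  congr (_ * _)%E; rewrite -exprMn -integral_std_expquad; last exact: c1.
  apply: eq_integral => x _; congr (expR _)%:E; ring.
transitivity (\int[normal 0 r]_x g x)%E; last first.
  apply: (@eq_trans _ _ (\int[std]_x g (r * x + 0)%R)%E).
    exact/esym/(integral_normal_affine 0 r0 mg g0).
  by apply: eq_integral => x _; rewrite addr0.
rewrite [LHS]integral_normal; last 2 first.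
- apply: emeasurable_funM => //; apply/measurable_EFinP; apply: measurable_funM => //.
  apply: measurableT_comp => //; apply: measurable_funM => //; apply: measurable_funM => //.
- by move=> x; rewrite mule_ge0// lee_fin mulr_ge0 ?expR_ge0// invr_ge0 ltW.
rewrite [RHS]integral_normal; [|exact: mg|exact: g0].
apply: eq_integral => x _; rewrite -muleA -EFinM; congr (_ * _%:E)%E.
rewrite !normal_pdf_gt0E ?ltr01// !subr0 invr1 expr1n mul1r mulr1 mulrACA -expRD mulrAC -mulrA.
rewrite r2 [LHS]mulrCA [LHS]mulrC; congr (_ * expR _).
by field; rewrite gt_eqF.
Qed.

Lemma std_conv (a b : R) (g : R -> \bar R) : 0 <= b ->
  measurable_fun setT g -> (forall x, 0 <= g x)%E ->
  (\int[std]_z \int[std]_w g (a * z + b * w)%R =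
   \int[std]_x g (Num.sqrt (a ^+ 2 + b ^+ 2) * x)%R)%E.
Proof.
(* The degenerate case [b = 0] occurs in [integral_lincomb] when the remaining coefficients vanish;
   [a] may be negative there, whence the appeal to symmetry. *)
rewrite le_eqVlt => /predU1P[<-|b0] mg g0.
  rewrite expr0n addr0 sqrtr_sqr.
  transitivity (\int[std]_z g (a * z)%R)%E.
    apply: eq_integral => z _; under eq_integral do rewrite mul0r addr0.
    by rewrite integral_cst// -[RHS]mule1; congr (_ * _)%E; exact: probability_setT.
  have [a0|a0] := ger0P a; first by [].
  have mga : measurable_fun setT (fun x => g (a * x)).
    by apply: measurableT_comp => //; exact: measurable_funM.
  rewrite -[LHS](integral_stdN mga); last by move=> x; exact: g0.
  by apply: eq_integral => x _; rewrite mulrN mulNr.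
have mgb : measurable_fun setT (fun y => g (b * y)).
  by apply: measurableT_comp => //; exact: measurable_funM.
have := @std_conv1 (a / b) _ mgb (fun x => g0 _).
have -> : (\int[std]_z \int[std]_w g (b * (a / b * z + w))%R =
    \int[std]_z \int[std]_w g (a * z + b * w)%R)%E.
  apply: eq_integral => z _; apply: eq_integral => w _; congr g.
  by field; rewrite gt_eqF.
move=> ->; apply: eq_integral => x _; rewrite mulrA; congr (g (_ * _)).
have -> : a ^+ 2 + b ^+ 2 = b ^+ 2 * (1 + (a / b) ^+ 2) by field; rewrite gt_eqF.
by rewrite sqrtrM ?sqr_ge0// sqrtr_sqr gtr0_norm.
Qed.

Lemma measurable_lincomb n (b : 'I_n -> R) :
  measurable_fun setT (fun x : n.-tuple R => \sum_(k < n) b k * tnth x k).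
Proof.
apply: measurable_sum => k; apply: measurable_funM => //.
exact: measurable_tnth.
Qed.

Lemma integral_lincomb n (b : 'I_n -> R) (g : R -> \bar R) :
  measurable_fun setT g -> (forall x, 0 <= g x)%E ->
  (\int[tprod (fun _ => std)]_x g (\sum_(k < n) b k * tnth x k)%R =
   \int[std]_x g (Num.sqrt (\sum_k b k ^+ 2) * x)%R)%E.
Proof.
elim: n => [|n IH] in b g *; move=> mg g0.
  under eq_integral do rewrite big_ord0.
  under [RHS]eq_integral do rewrite big_ord0 sqrtr0 mul0r.
  by rewrite !integral_cst//; congr (_ * _)%E; rewrite [RHS]probability_setT; exact: probability_setT.
have mG := measurableT_comp mg (measurable_lincomb b).
rewrite /= (integral_law _ _ mG); last by move=> y; exact: g0.
rewrite (fubini_tonelli1 _ (measurableT_comp mG (@measurable_tcons _ _ n)))/=; last first.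
  by move=> y; exact: g0.
transitivity (\int[std]_z \int[tprod (fun=> std)]_y
    g (b ord0 * z + \sum_(k < n) b (lift ord0 k) * tnth y k)%R)%E.
  apply: eq_integral => z _; apply: eq_integral => y _ /=; congr g.
  by rewrite big_ord_recl; congr (_ + _); apply: eq_bigr => k _; rewrite tnthS.
transitivity (\int[std]_z \int[std]_w g (b ord0 * z +
    Num.sqrt (\sum_(k < n) b (lift ord0 k) ^+ 2) * w)%R)%E.
  apply: eq_integral => z _.
  rewrite (IH (fun k => b (lift ord0 k)) (fun y => g (b ord0 * z + y)%R))//.
  by apply: measurableT_comp => //; exact: measurable_funD.
rewrite std_conv//; apply: eq_integral => x _.
by rewrite sqr_sqrtr ?sumr_ge0// => [|i _]; rewrite ?big_ord_recl ?sqr_ge0.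
Qed.

(** As the law of [sqrt v] times a standard variable, N(0, v) includes the Dirac mass at [v = 0], so
    later computations need no case distinction. *)
Lemma centered_normalE (v : R) (B : set R) : 0 <= v -> measurable B ->
  centered_normal v B = (\int[std]_x (\1_B (Num.sqrt v * x))%:E)%E.
Proof.
move=> v0 mB; rewrite /centered_normal; case: eqP => [->|/eqP v1].
  under eq_integral do rewrite sqrtr0 mul0r.
  rewrite integral_cst// diracE indicE -[LHS]mule1; congr (_ * _)%E.
  exact/esym/probability_setT.
have s0 : 0 < Num.sqrt v by rewrite sqrtr_gt0 lt_neqAle eq_sym v1.
have mI : measurable_fun setT (fun x => (\1_B x)%:E : \bar R).
  exact/measurable_EFinP/measurable_indic.
transitivity (\int[normal 0 (Num.sqrt v)]_x (\1_B x)%:E)%E; last first.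
  apply: (@eq_trans _ _ (\int[std]_x (\1_B (Num.sqrt v * x + 0)%R)%:E)%E).
    by apply/esym/(integral_normal_affine 0 s0 mI) => x; rewrite lee_fin.
  by apply: eq_integral => x _; rewrite addr0.
by rewrite integral_indic_setT.
Qed.

Definition std_var : \bar R := (\int[std]_x (x ^+ 2)%:E)%E.

(** A crude bound on the second moment is enough: x^2 <= 4 exp (x^2 / 4), whose mean is 4 sqrt 2 <
    6. The 6 is the source of the constant 3/2 in the divergence bound. *)
Lemma std_var_le : (std_var <= 6%:R%:E)%E.
Proof.
have s2 : 0 < 1 + - (1 / 2) :> R by lra.
have mf : measurable_fun setT (fun x : R => (expR (0 * x - (- (1 / 2)) * x ^+ 2 / 2))%:E).
  apply/measurable_EFinP; apply: measurableT_comp => //; apply: measurable_funB => //.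
  by do 2 apply: measurable_funM => //.
apply: (@le_trans _ _ (\int[std]_x (4%:E * (expR (0 * x - (- (1 / 2)) * x ^+ 2 / 2))%:E)))%E.
  apply: ge0_le_integral => //=.
  - by move=> x _; rewrite lee_fin sqr_ge0.
  - exact/measurable_EFinP.
  - by apply: emeasurable_funM.
  - move=> x _; rewrite -EFinM lee_fin.
    have := expR_ge1Dx (0 * x - (- (1 / 2)) * x ^+ 2 / 2).
    nra.
rewrite ge0_integralZl//.
rewrite integral_std_expquad// expr0n/= mul0r expR0 mulr1 -EFinM lee_fin.
have -> : 1 + - (1 / 2) = 2^-1 :> R by field.
rewrite sqrtrV// invrK.
have := sqr_ge0 (Num.sqrt 2 - 3/2 : R); have := @sqr_sqrtr R 2.
nra.
Qed.

End convolution.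

(** * The spiked Gaussian law *)

Section tprod_map.
Local Open Scope classical_set_scope.
Context d (T : measurableType d) (R : realType) (n : nat).
Variables (mu nu : 'I_n -> probability T R) (f : 'I_n -> T -> T).
Hypothesis mf : forall i, measurable_fun setT (f i).
Hypothesis nuE : forall i A, measurable A -> nu i A = mu i (f i @^-1` A).

Definition tmap (x : n.-tuple T) : n.-tuple T := [tuple f i (tnth x i) | i < n].

Lemma measurable_tmap : measurable_fun setT tmap.
Proof.
apply/measurable_fun_tnthP => i.
rewrite (_ : _ \o _ = fun x => f i (tnth x i)); last first.
  by apply/funext => x; rewrite /= tnth_mktuple.
by apply: measurableT_comp => //; exact: measurable_tnth.
Qed.

Lemma tprod_map B : measurable B -> tprod nu B = tprod mu (tmap @^-1` B).
Proof.
move=> mB; rewrite -[RHS]/(law (tprod mu) measurable_tmap B).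
apply: tuple_measure_unique => //.
  by apply: (@le_lt_trans _ _ 1%E); [exact: probability_le1|exact: ltry].
move=> A mA; have mfA i : measurable (f i @^-1` A i).
  by rewrite -[X in measurable X]setTI; exact: mf.
apply: (@eq_trans _ _ (\prod_(i < n) nu i (A i))%E); first exact: tprod_box.
apply: (@eq_trans _ _ (tprod mu (box (fun i => f i @^-1` A i)))).
  by rewrite tprod_box//; apply: eq_bigr => i _; exact: nuE.
rewrite [RHS]lawE; congr (_ _); apply/seteqP; split => x /= h i.
  by rewrite tnth_mktuple; exact: h.
by have := h i; rewrite tnth_mktuple.
Qed.

End tprod_map.

Section spiked.
Local Open Scope classical_set_scope.
Context {R : realType}.
Variables (d K : nat) (sigma : R) (V : 'M[R]_(d, K)).
Hypothesis sigma0 : 0 <= sigma.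
Local Notation std := (@std R).
Local Notation gauss n := (tprod (fun _ : 'I_n => std)).

(** The factor model: for independent standard Gaussian [z] and [w], the vector [sqrt sigma V z + w]
    has covariance [sigma V V^T + I]. *)
Definition spike_map (x : K.-tuple R * d.-tuple R) : d.-tuple R :=
  [tuple Num.sqrt sigma * (\sum_k V i k * tnth x.1 k) + tnth x.2 i | i < d].

Lemma measurable_spike_map : measurable_fun setT spike_map.
Proof.
apply/measurable_fun_tnthP => i.
rewrite (_ : _ \o _ = fun x : K.-tuple R * d.-tuple R =>
    Num.sqrt sigma * (\sum_k V i k * tnth x.1 k) + tnth x.2 i); last first.
  by apply/funext => x; rewrite /= tnth_mktuple.
apply: measurable_funD.
  apply: measurable_funM => //.
  by apply: (measurableT_comp (measurable_lincomb (fun k => V i k))).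
by apply: (measurableT_comp (measurable_tnth i)).
Qed.

Definition spiked : probability (d.-tuple R) R :=
  law (gauss K \x gauss d)%E measurable_spike_map.

Lemma spiked_cov_quad (a : 'rV[R]_d) :
  (a *m spiked_cov sigma V *m a^T) 0 0 =
  sigma * (\sum_k (a *m V) 0 k ^+ 2) + \sum_i a 0 i ^+ 2.
Proof.
rewrite /spiked_cov mulmxDr mulmx1 mulmxDl mxE; congr (_ + _); last first.
  by rewrite mxE; apply: eq_bigr => i _; rewrite mxE expr2.
rewrite -scalemxAr -scalemxAl mxE.
have -> : a *m (V *m V^T) *m a^T = (a *m V) *m (a *m V)^T by rewrite trmx_mul !mulmxA.
rewrite [X in _ * X]mxE.
by congr (_ * _); apply: eq_bigr => i _; rewrite [_^T _ _]mxE expr2.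
Qed.

Lemma integral_spiked_lincomb (a : 'rV[R]_d) (g : R -> \bar R) :
  measurable_fun setT g -> (forall x, 0 <= g x)%E ->
  (\int[spiked]_x g (\sum_i a 0 i * tnth x i)%R =
   \int[std]_x g (Num.sqrt ((a *m spiked_cov sigma V *m a^T) 0 0) * x)%R)%E.
Proof.
move=> mg g0.
have mG := measurableT_comp mg (measurable_lincomb (fun i => a 0 i)).
rewrite (integral_law _ _ mG); last by move=> y; exact: g0.
pose b k : R := Num.sqrt sigma * (a *m V) 0 k.
have mGs := measurableT_comp mG measurable_spike_map.
rewrite (fubini_tonelli1 _ mGs); last by move=> y; exact: g0.
pose al : R := Num.sqrt (\sum_i a 0 i ^+ 2).
have mz (z : K.-tuple R) : measurable_fun setT (fun y : R => g (\sum_k b k * tnth z k + y)).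
  by apply: measurableT_comp => //; exact: measurable_funD.
(* For fixed [z] the noise coordinates collapse to one Gaussian variable. After exchanging the
   integrals the factor coordinates do too, which leaves two variables for [std_conv]. *)
transitivity (\int[gauss K]_z \int[std]_x g (\sum_k b k * tnth z k + al * x)%R)%E.
  apply: eq_integral => z _.
  rewrite -(integral_lincomb (fun i => a 0 i) (mz z)); last by move=> y; exact: g0.
  apply: eq_integral => y _ /=; congr g.
  under eq_bigr do rewrite tnth_mktuple/= mulrDr.
  rewrite big_split/=; congr (_ + _).
  under eq_bigr do rewrite mulrCA.
  rewrite -mulr_sumr /b; under [RHS]eq_bigr do rewrite -mulrA.
  rewrite -mulr_sumr; congr (_ * _).
  under eq_bigr do rewrite mulr_sumr.
  rewrite exchange_big; apply: eq_bigr => k _ /=.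
  by rewrite mxE mulr_suml; apply: eq_bigr => i _; rewrite mulrA.
pose F (x : K.-tuple R * R) := g (\sum_k b k * tnth x.1 k + al * x.2)%R.
have mF : measurable_fun setT F.
  apply: measurableT_comp => //; apply: measurable_funD.
    exact: (measurableT_comp (measurable_lincomb b)).
  exact: measurable_funM.
rewrite (fubini_tonelli F mF (fun x => g0 _)).
pose be : R := Num.sqrt (\sum_k b k ^+ 2).
transitivity (\int[std]_x \int[std]_z g (be * z + al * x)%R)%E.
  apply: eq_integral => x _.
  have mx : measurable_fun setT (fun y : R => g (y + al * x)).
    by apply: measurableT_comp => //; exact: measurable_funD.
  by apply: (integral_lincomb b mx) => y; exact: g0.
pose F2 (x : R * R) := g (be * x.2 + al * x.1)%R.
have mF2 : measurable_fun setT F2.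
  by apply: measurableT_comp => //; apply: measurable_funD; apply: measurable_funM.
rewrite (fubini_tonelli F2 mF2 (fun x => g0 _)).
rewrite std_conv ?sqrtr_ge0//; apply: eq_integral => x _; congr (g (Num.sqrt _ * _)).
rewrite spiked_cov_quad !sqr_sqrtr; last 2 first.
- by apply: sumr_ge0 => i _; exact: sqr_ge0.
- by apply: sumr_ge0 => i _; exact: sqr_ge0.
congr (_ + _); rewrite mulr_sumr; apply: eq_bigr => k _.
by rewrite exprMn sqr_sqrtr.
Qed.

Lemma spiked_gaussian (a : 'rV[R]_d) (B : set R) : measurable B ->
  spiked [set x | B (\sum_k a 0 k * tnth x k)] =
  centered_normal ((a *m spiked_cov sigma V *m a^T) 0 0) B.
Proof.
move=> mB; have mI : measurable_fun setT (fun x => (\1_B x)%:E : \bar R).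
  exact/measurable_EFinP/measurable_indic.
rewrite centered_normalE//; last first.
  rewrite spiked_cov_quad addr_ge0 ?mulr_ge0 ?sumr_ge0// => i _; exact: sqr_ge0.
rewrite -(integral_spiked_lincomb a mI); last by move=> x; rewrite lee_fin.
rewrite -[LHS]integral_indic_setT//.
have := measurable_lincomb (fun i => a 0 i) measurableT mB.
by rewrite setTI.
Qed.

Lemma integral_spiked_sqr (a : 'rV[R]_d) :
  (\int[spiked]_x ((\sum_i a 0 i * tnth x i) ^+ 2)%:E =
   ((a *m spiked_cov sigma V *m a^T) 0 0)%:E * std_var)%E.
Proof.
have mg : measurable_fun setT (fun x : R => (x ^+ 2)%:E).
  exact/measurable_EFinP.
rewrite (integral_spiked_lincomb a mg); last by move=> x; rewrite lee_fin sqr_ge0.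
rewrite -ge0_integralZl//; last 2 first.
- by move=> x _; rewrite lee_fin sqr_ge0.
- rewrite lee_fin spiked_cov_quad addr_ge0 ?mulr_ge0 ?sumr_ge0// => i _; exact: sqr_ge0.
apply: eq_integral => x _; rewrite -EFinM exprMn sqr_sqrtr//.
rewrite spiked_cov_quad addr_ge0 ?mulr_ge0 ?sumr_ge0// => i _; exact: sqr_ge0.
Qed.

End spiked.

Section shift.
Local Open Scope classical_set_scope.
Context {R : realType}.
Local Notation std := (@std R).
Local Notation gauss n := (tprod (fun _ : 'I_n => std)).

Lemma measurable_shiftR (h : R) : measurable_fun setT (fun x : R => x + h).
Proof. exact: measurable_funD. Qed.

Definition shift_dens (h x : R) := expR (h * x - h ^+ 2 / 2).

Lemma measurable_shift_dens h : measurable_fun setT (shift_dens h).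
Proof.
by apply: measurableT_comp => //; apply: measurable_funB => //;
   exact: measurable_funM.
Qed.

Lemma gauss_shift d (h : 'I_d -> R) B : measurable B ->
  (gauss d (tmap (fun i (x : R) => x + h i)%R @^-1` B) =
   \int[gauss d]_(x in B) (\prod_(i < d) shift_dens (h i) (tnth x i))%:E)%E.
Proof.
move=> mB; pose nu i := law std (measurable_shiftR (h i)).
apply: (@eq_trans _ _ (tprod nu B)).
  apply/esym/tprod_map => // i; exact: measurable_shiftR.
apply: (@tprod_density _ _ _ d (fun=> std) nu (fun i => shift_dens (h i))) => //.
- by move=> i; exact: measurable_shift_dens.
- by move=> i x; exact: expR_ge0.
- move=> i A mA; rewrite lawE.
  have mI : measurable_fun setT (fun x => (\1_A x)%:E : \bar R).
    exact/measurable_EFinP/measurable_indic.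
  apply: (@eq_trans _ _ (\int[std]_x (\1_A (x + h i))%:E)%E).
    rewrite -integral_indic_setT//.
    by rewrite -[X in measurable X]setTI; exact: measurable_shiftR.
  rewrite (integral_std_shift (h i) mI); last by move=> x; rewrite lee_fin.
  rewrite [RHS]integral_mkcond; apply: eq_integral => x _.
  by rewrite patchE indicE; case: ifP; rewrite ?mul1e ?mul0e.
Qed.

End shift.

Section spiked_density.
Local Open Scope classical_set_scope.
Context {R : realType}.
Variables (d K : nat) (sigma : R) (V : 'M[R]_(d, K)).
Hypothesis sigma0 : 0 <= sigma.
Hypothesis oV : orthonormal_columns V.
Local Notation std := (@std R).
Local Notation gauss n := (tprod (fun _ : 'I_n => std)).

Definition score (k : 'I_K) (x : d.-tuple R) : R := \sum_i V i k * tnth x i.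

Lemma measurable_score k : measurable_fun setT (score k).
Proof. exact: measurable_lincomb. Qed.

(** Density of the spiked law with respect to N(0, I) when [V] has orthonormal columns: the
    covariance then has determinant (1 + sigma)^K and inverse [I - sigma / (1 + sigma) V V^T], so
    only the scores [V^T x] enter. *)
Definition spike_dens (x : d.-tuple R) : R :=
  \prod_(k < K) ((Num.sqrt (1 + sigma))^-1 *
                 expR (sigma * score k x ^+ 2 / (2 * (1 + sigma)))).

Lemma measurable_spike_dens : measurable_fun setT spike_dens.
Proof.
apply: measurable_prod => k _; apply: measurable_funM => //.
apply: measurableT_comp => //; apply: measurable_funM => //.
apply: measurable_funM => //; apply: measurable_funX; exact: measurable_score.
Qed.

Lemma spike_dens_gt0 x : 0 < spike_dens x.
Proof.
apply: prodr_gt0 => k _; rewrite mulr_gt0 ?expR_gt0// invr_gt0 sqrtr_gt0.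
by rewrite ltr_wpDr.
Qed.

Lemma ortho_sum (z : 'I_K -> R) :
  \sum_i (\sum_k V i k * z k) ^+ 2 = \sum_k z k ^+ 2.
Proof.
pose v : 'cV[R]_K := \col_k z k.
have -> : \sum_i (\sum_k V i k * z k) ^+ 2 = ((V *m v)^T *m (V *m v)) 0 0.
  rewrite mxE; apply: eq_bigr => i _; rewrite mxE expr2.
  by congr (_ * _); rewrite mxE; apply: eq_bigr => k _; rewrite mxE.
rewrite trmx_mul mulmxA -(mulmxA _ V^T) oV mulmx1 mxE.
by apply: eq_bigr => k _; rewrite !mxE expr2.
Qed.

(** Because [V] is an isometry, the Cameron-Martin weight of the shift [sqrt sigma V z] splits over
    the coordinates of [z], which makes the integral over [z] a product. *)
Lemma shift_dens_spike (z : K.-tuple R) (x : d.-tuple R) :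
  \prod_(i < d) shift_dens (Num.sqrt sigma * (\sum_k V i k * tnth z k)) (tnth x i) =
  \prod_(k < K) expR (Num.sqrt sigma * score k x * tnth z k - sigma * tnth z k ^+ 2 / 2).
Proof.
rewrite /shift_dens -!expR_sum; congr expR.
rewrite !sumrB; congr (_ - _).
  under eq_bigr do rewrite -mulrA.
  rewrite -mulr_sumr; under [RHS]eq_bigr do rewrite -mulrA.
  rewrite -mulr_sumr; congr (_ * _).
  under eq_bigr do rewrite mulr_suml.
  rewrite exchange_big; apply: eq_bigr => k _ /=.
  by rewrite /score mulr_suml; apply: eq_bigr => i _; rewrite mulrAC.
rewrite -!mulr_suml; congr (_ * _).
under eq_bigr do rewrite exprMn.
transitivity (Num.sqrt sigma ^+ 2 * \sum_i (\sum_k V i k * tnth z k) ^+ 2).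
  by rewrite mulr_sumr.
by rewrite (ortho_sum (tnth z)) sqr_sqrtr// mulr_sumr.
Qed.

(** Given the factor [z], the law is a translate of N(0, I). Averaging its Cameron-Martin density
    over [z] gives K one-dimensional Gaussian integrals, and no determinant or inverse has to be
    computed. *)
Lemma spiked_density A : measurable A ->
  (spiked sigma V A = \int[gauss d]_(x in A) (spike_dens x)%:E)%E.
Proof.
move=> mA; have mI : measurable_fun setT (fun x => (\1_A x)%:E : \bar R).
  exact/measurable_EFinP/measurable_indic.
rewrite -[LHS]integral_indic_setT//.
rewrite (integral_law _ _ mI); last by move=> y; rewrite lee_fin.
have mIs := measurableT_comp mI (measurable_spike_map sigma V).
rewrite (fubini_tonelli1 _ mIs); last by move=> y; rewrite lee_fin.
pose F (x : K.-tuple R * d.-tuple R) := (\1_A x.2 * \prod_(k < K)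
  expR (Num.sqrt sigma * score k x.2 * tnth x.1 k - sigma * tnth x.1 k ^+ 2 / 2)).
have F0 x : (0 <= (F x)%:E)%E.
  by rewrite lee_fin mulr_ge0// prodr_ge0// => k _; exact: expR_ge0.
have mF : measurable_fun setT (fun x => (F x)%:E).
  apply/measurable_EFinP; apply: measurable_funM.
    exact: (measurableT_comp (measurable_indic mA) measurable_snd).
  apply: measurable_prod => k _; apply: measurableT_comp => //.
  have mt : measurable_fun setT (fun x : K.-tuple R * d.-tuple R => tnth x.1 k).
    exact: (measurableT_comp (measurable_tnth k) measurable_fst).
  apply: measurable_funB; last by do 2 apply: measurable_funM => //; exact: measurable_funX.
  apply: measurable_funM => //; apply: measurable_funM => //.
  exact: (measurableT_comp (measurable_score k) measurable_snd).
apply: (@eq_trans _ _ (\int[gauss K]_z \int[gauss d]_x (F (z, x))%:E)%E).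
  apply: eq_integral => z _.
  pose h i : R := Num.sqrt sigma * (\sum_k V i k * tnth z k).
  have mh : measurable (tmap (fun i (x : R) => x + h i) @^-1` A).
    rewrite -[X in measurable X]setTI.
    by apply: (measurable_tmap (fun i => measurable_shiftR (h i))).
  apply: (@eq_trans _ _ (gauss d (tmap (fun i (x : R) => x + h i) @^-1` A))).
    rewrite -integral_indic_setT//; apply: eq_integral => w _.
    rewrite /= !indicE; congr ((_ \in A)%:R)%:E.
    by apply: eq_from_tnth => i; rewrite !tnth_mktuple addrC.
  rewrite gauss_shift// integral_mkcond; apply: eq_integral => x _.
  by rewrite patchE shift_dens_spike /F/= indicE; case: ifP; rewrite ?mul1r ?mul0r.
rewrite (fubini_tonelli _ mF F0) [RHS]integral_mkcond.
apply: eq_integral => x _; rewrite patchE /F/= indicE; case: ifP => _ /=; last first.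
  by under eq_integral do rewrite mul0r; rewrite integral_cst// mul0e.
under eq_integral do rewrite mul1r -prodEFin.
have mE k : measurable_fun setT (fun t : R =>
    (expR (Num.sqrt sigma * score k x * t - sigma * t ^+ 2 / 2))%:E).
  apply/measurable_EFinP; apply: measurableT_comp => //; apply: measurable_funB.
    exact: measurable_funM.
  by do 2 apply: measurable_funM => //.
rewrite (integral_tprod _ mE); last by move=> k t; rewrite lee_fin expR_ge0.
rewrite -prodEFin; apply: eq_bigr => k _.
have s1 : 0 < 1 + sigma by rewrite ltr_wpDr.
rewrite (integral_std_expquad _ s1) exprMn sqr_sqrtr; last exact: sigma0.
reflexivity.
Qed.

End spiked_density.

(** * Changes of measure *)

Section llr.
Local Open Scope classical_set_scope.
Context d (T : measurableType d) (R : realType).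
Implicit Types P Q : probability T R.

(* [D : llr_data P Q kappa] bounds the Kullback-Leibler divergence KL(P, Q) by
   [kappa]. The log-likelihood ratio is split into nonnegative parts with
   finite [P]-means. *)
Record llr_data P Q (kappa : R) := LlrData {
  llr_mu : probability T R;
  llr_f : T -> R;
  llr_g : T -> R;
  llr_pos : T -> R;
  llr_neg : T -> R;
  llr_epos : R;
  llr_eneg : R;
  llr_mf : measurable_fun setT llr_f;
  llr_mg : measurable_fun setT llr_g;
  llr_mpos : measurable_fun setT llr_pos;
  llr_mneg : measurable_fun setT llr_neg;
  llr_g0 : forall x, 0 < llr_g x;
  llr_pos0 : forall x, 0 <= llr_pos x;
  llr_neg0 : forall x, 0 <= llr_neg x;
  llr_fE : forall x, llr_f x = llr_g x * expR (llr_pos x - llr_neg x);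
  llr_Pf : forall A, measurable A -> (P A = \int[llr_mu]_(x in A) (llr_f x)%:E)%E;
  llr_Qg : forall A, measurable A -> (Q A = \int[llr_mu]_(x in A) (llr_g x)%:E)%E;
  llr_Epos : (\int[P]_x (llr_pos x)%:E = llr_epos%:E)%E;
  llr_Eneg : (\int[P]_x (llr_neg x)%:E = llr_eneg%:E)%E;
  llr_kappa : llr_epos - llr_eneg <= kappa }.

Variables (P Q : probability T R) (kappa : R) (D : llr_data P Q kappa).
Local Notation mu := (llr_mu D).
Local Notation f := (llr_f D).
Local Notation g := (llr_g D).
Local Notation S1 := (llr_pos D).
Local Notation S0 := (llr_neg D).

Lemma llr_f0 x : 0 < f x.
Proof. by rewrite llr_fE mulr_gt0 ?llr_g0 ?expR_gt0. Qed.

Lemma integral_llr_f (h : T -> \bar R) : measurable_fun setT h ->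
  (forall x, 0 <= h x)%E -> (\int[P]_x h x = \int[mu]_x (h x * (f x)%:E))%E.
Proof.
move=> mh h0; apply: integral_density => //; first exact: llr_mf.
  by move=> x; rewrite ltW ?llr_f0.
exact: llr_Pf.
Qed.

Lemma llr_intf : (\int[mu]_x (f x)%:E = 1)%E.
Proof. by rewrite -llr_Pf// ; exact: probability_setT. Qed.

Lemma llr_intg : (\int[mu]_x (g x)%:E = 1)%E.
Proof. by rewrite -llr_Qg// ; exact: probability_setT. Qed.

Lemma measurable_llr : measurable_fun setT (fun x => S1 x - S0 x).
Proof. by apply: measurable_funB; [exact: llr_mpos|exact: llr_mneg]. Qed.

Lemma integral_expRN_llr : (\int[P]_x (expR (- (S1 x - S0 x)))%:E = 1)%E.
Proof.
rewrite integral_llr_f; last 2 first.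
- apply/measurable_EFinP; apply: measurableT_comp => //.
  exact: (measurableT_comp _ measurable_llr).
- by move=> x; rewrite lee_fin expR_ge0.
rewrite -llr_intg; apply: eq_integral => x _.
rewrite -EFinM; congr EFin; rewrite llr_fE mulrCA -expRD addNr expR0 mulr1 //.
Qed.

Lemma measurable_llr_gt (l : R) : measurable [set x | (l < S1 x - S0 x)%R].
Proof.
rewrite -[X in measurable X]setTI
  -[X in _ `&` X](_ : (fun x => S1 x - S0 x) @^-1` `]l, +oo[ = _).
  exact: measurable_llr.
by apply/seteqP; split => x /=; rewrite in_itv/= andbT.
Qed.

(** Markov's inequality for a log-likelihood ratio L of either sign: l 1(L > l) <= L + exp (- L),
    because L + exp (- L) >= 1. The exponential has mean 1 under P, hence [kappa + 1]. The part [S0]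
    is moved to the left so that both integrands are nonnegative. *)
Lemma llr_tail (l : R) : 0 < l ->
  (l%:E * P [set x | (l < S1 x - S0 x)%R] <= (kappa + 1)%:E)%E.
Proof.
move=> l0; set A := [set x | _]; have mA := measurable_llr_gt l.
have mI : measurable_fun setT (fun x => (\1_A x)%:E : \bar R).
  exact/measurable_EFinP/measurable_indic.
have mp : measurable_fun setT (fun x => (S1 x)%:E) by apply/measurable_EFinP; exact: llr_mpos.
have mn : measurable_fun setT (fun x => (S0 x)%:E) by apply/measurable_EFinP; exact: llr_mneg.
have me : measurable_fun setT (fun x => (expR (- (S1 x - S0 x)))%:E).
  apply/measurable_EFinP; apply: measurableT_comp => //.
  exact: (measurableT_comp _ measurable_llr).
have : (\int[P]_x (l%:E * (\1_A x)%:E + (S0 x)%:E) <=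
        \int[P]_x ((S1 x)%:E + (expR (- (S1 x - S0 x)))%:E))%E.
  apply: ge0_le_integral => //.
  - move=> x _; rewrite -EFinM -EFinD lee_fin addr_ge0 ?llr_neg0//.
    by rewrite mulr_ge0// ltW.
  - by apply: emeasurable_funD => //; exact: emeasurable_funM.
  - by apply: emeasurable_funD.
  - move=> x _; rewrite -EFinM -!EFinD lee_fin indicE.
    have := expR_gt0 (- (S1 x - S0 x)); have := expR_ge1Dx (- (S1 x - S0 x)).
    case: (boolP (x \in A)) => [/set_mem/= Ax|_]; last by rewrite mulr0; lra.
    by have Ax2 : l < S1 x - S0 x := Ax; rewrite mulr1; lra.
rewrite ge0_integralD//; last 3 first.
- by move=> x _; rewrite -EFinM lee_fin mulr_ge0// ltW.
- exact: emeasurable_funM.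
- by move=> x _; rewrite lee_fin llr_neg0.
rewrite ge0_integralD//; last first.
  by move=> x _; rewrite lee_fin llr_pos0.
rewrite ge0_integralZl//; last by rewrite lee_fin ltW.
have pE : P A = (fine (P A))%:E by rewrite fineK// fin_num_measure.
have -> : (\int[P]_x (\1_A x)%:E = (fine (P A))%:E)%E by rewrite integral_indic_setT.
rewrite integral_expRN_llr llr_Epos llr_Eneg pE.
rewrite -!EFinM -!EFinD !lee_fin. have := llr_kappa D; lra.
Qed.

(** Where the log-likelihood ratio is at most [l], the density [f] is at most exp l times [g];
    [llr_tail] pays for the rest. *)
Lemma llr_change_measure (l : R) (A : set T) : 0 < l -> measurable A ->
  (P A <= (expR l)%:E * Q A + ((kappa + 1) / l)%:E)%E.
Proof.
move=> l0 mA; set B := [set x | (l < S1 x - S0 x)%R]; have mB := measurable_llr_gt l.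
have -> : A = (A `\` B) `|` (A `&` B) by rewrite setUC setUIDK.
have mAB : measurable (A `\` B) by exact: measurableD.
apply: (@le_trans _ _ (P (A `\` B) + P (A `&` B))%E).
  by apply: measureU2 => //; exact: measurableI.
rewrite setUC setUIDK; apply: leeD.
  rewrite (llr_Pf D)//; apply: (@le_trans _ _ ((expR l)%:E * Q (A `\` B))%E); last first.
    rewrite lee_wpmul2l ?lee_fin ?expR_ge0//; apply: le_measure; rewrite ?inE//; exact: subDsetl.
  have mgB : measurable_fun (A `\` B) (fun x => (g x)%:E).
    by apply/measurable_EFinP; apply: measurable_funTS; exact: llr_mg.
  have mfB : measurable_fun (A `\` B) (fun x => (f x)%:E).
    by apply/measurable_EFinP; apply: measurable_funTS; exact: llr_mf.
  have g0B x : (A `\` B) x -> (0 <= (g x)%:E)%E by move=> _; rewrite lee_fin ltW// llr_g0.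
  rewrite (llr_Qg D)// -ge0_integralZl ?lee_fin ?expR_ge0//.
  apply: ge0_le_integral => //.
  - by move=> x _; rewrite lee_fin ltW// llr_f0.
  - exact: emeasurable_funM.
  - move=> x [_ /= /negP]; rewrite -leNgt => xl; rewrite -EFinM lee_fin llr_fE mulrC.
    by rewrite ler_pM2r ?llr_g0// ler_expR.
have mB' : measurable (A `&` B) by exact: measurableI.
apply: (@le_trans _ _ (P B)); first by apply: le_measure; rewrite ?inE//; exact: subIsetr.
have := llr_tail l0; rewrite -/B.
have -> : P B = (fine (P B))%:E by rewrite fineK// fin_num_measure.
by rewrite -EFinM !lee_fin ler_pdivlMr// mulrC.
Qed.

(* [f * g = f ^+ 2 * expR (- (S1 - S0))], so [1 - (S1 - S0) / 2] bounds the
   Hellinger affinity density from below, and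
   [max f g] is compared with [f + g] and [Num.sqrt (f * g)] by AM-GM. *)
Lemma llr_max_pointwise (e : R) (x : T) : 0 < e ->
  Num.max (f x) (g x) + (e^-1 * f x + (2 * e)^-1 * (f x * S0 x)) <=
  (2^-1 + (2 * e)^-1 + e / 4) * (f x + g x) + (2 * e)^-1 * (f x * S1 x).
Proof.
move=> e0.
set u := (S1 x - S0 x) / 2; pose w := expR (- u).
have w0 : 0 < w by exact: expR_gt0.
have w1 : 1 - u <= w by exact: expR_ge1Dx.
have gE : g x = f x * w ^+ 2.
  rewrite llr_fE -mulrA /w expr2 -!expRD -[LHS]mulr1 -expR0; congr (_ * expR _).
  by rewrite /u; field.
rewrite gE; set F := f x; have F0 : 0 < F by exact: llr_f0.
have -> : Num.max F (F * w ^+ 2) = F * Num.max 1 (w ^+ 2).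
  by rewrite maxr_pMr ?ltW// mulr1.
have ei : e * e^-1 = 1 by rewrite mulfV// gt_eqF.
rewrite -subr_ge0.
have -> : (2^-1 + (2 * e)^-1 + e / 4) * (F + F * w ^+ 2) + (2 * e)^-1 * (F * S1 x) -
    (F * Num.max 1 (w ^+ 2) + (e^-1 * F + (2 * e)^-1 * (F * S0 x))) =
  F * e^-1 * (e * (2^-1 + e / 4) * (1 + w ^+ 2) + 2^-1 * (1 + w ^+ 2)
    - e * Num.max 1 (w ^+ 2) - (1 - u)).
  by rewrite /u; field; rewrite gt_eqF.
rewrite mulr_ge0 ?mulr_ge0 ?invr_ge0 ?(ltW F0) ?(ltW e0)//.
have h1 := sqr_ge0 ((1 - w) - e / 2 * (1 + w)).
have h2 := sqr_ge0 ((1 - w) + e / 2 * (1 + w)).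
have h3 := sqr_ge0 (e * (1 - w)).
by rewrite maxEle; case: ifP => _; nra.
Qed.

(** A Pinsker inequality, since the integral of [max f g] is 1 plus the total variation distance.
    Integrating the pointwise bound gives 1 + e / 2 + kappa / (2 e). *)
Lemma llr_integral_max (e : R) : 0 < e -> kappa <= e ^+ 2 ->
  (\int[mu]_x (Num.max (f x) (g x))%:E <= (1 + e)%:E)%E.
Proof.
move=> e0 ke.
have mf : measurable_fun setT (fun x => (f x)%:E) by apply/measurable_EFinP; exact: llr_mf.
have mg : measurable_fun setT (fun x => (g x)%:E) by apply/measurable_EFinP; exact: llr_mg.
have mp : measurable_fun setT (fun x => (f x * S1 x)%:E).
  by apply/measurable_EFinP; apply: measurable_funM; [exact: llr_mf|exact: llr_mpos].
have mn : measurable_fun setT (fun x => (f x * S0 x)%:E).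
  by apply/measurable_EFinP; apply: measurable_funM; [exact: llr_mf|exact: llr_mneg].
have mm : measurable_fun setT (fun x => (Num.max (f x) (g x))%:E).
  by apply/measurable_EFinP; apply: measurable_maxr; [exact: llr_mf|exact: llr_mg].
have f0 x : 0 <= f x by rewrite ltW// llr_f0.
have g0 x : 0 <= g x by rewrite ltW// llr_g0.
have fS1 : (\int[mu]_x (f x * S1 x)%:E = (llr_epos D)%:E)%E.
  rewrite -llr_Epos integral_llr_f; last 2 first.
  - by apply/measurable_EFinP; exact: llr_mpos.
  - by move=> x; rewrite lee_fin llr_pos0.
  by apply: eq_integral => x _; rewrite mulrC.
have fS0 : (\int[mu]_x (f x * S0 x)%:E = (llr_eneg D)%:E)%E.
  rewrite -llr_Eneg integral_llr_f; last 2 first.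
  - by apply/measurable_EFinP; exact: llr_mneg.
  - by move=> x; rewrite lee_fin llr_neg0.
  by apply: eq_integral => x _; rewrite mulrC.
set c := (2^-1 + (2 * e)^-1 + e / 4).
have c0 : 0 <= c by rewrite !addr_ge0 ?invr_ge0 ?divr_ge0 ?mulr_ge0// ltW.
have e20 : 0 <= (2 * e)^-1 by rewrite invr_ge0 mulr_ge0// ltW.
have ei0 : 0 <= e^-1 by rewrite invr_ge0 ltW.
have fS10 x : 0 <= f x * S1 x by rewrite mulr_ge0// llr_pos0.
have fS00 x : 0 <= f x * S0 x by rewrite mulr_ge0// llr_neg0.
have m0 x : 0 <= Num.max (f x) (g x) by rewrite le_max f0.
have mf2 : measurable_fun setT (fun x => e^-1%:E * (f x)%:E)%E by exact: emeasurable_funM.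
have mn2 : measurable_fun setT (fun x => (2 * e)^-1%:E * (f x * S0 x)%:E)%E.
  exact: emeasurable_funM.
have mp2 : measurable_fun setT (fun x => (2 * e)^-1%:E * (f x * S1 x)%:E)%E.
  exact: emeasurable_funM.
have mfg : measurable_fun setT (fun x => (f x)%:E + (g x)%:E)%E by exact: emeasurable_funD.
have mfg2 : measurable_fun setT (fun x => c%:E * ((f x)%:E + (g x)%:E))%E.
  exact: emeasurable_funM.
have mfn : measurable_fun setT
    (fun x => e^-1%:E * (f x)%:E + (2 * e)^-1%:E * (f x * S0 x)%:E)%E.
  exact: emeasurable_funD.
have f0E x : setT x -> (0 <= (f x)%:E)%E by rewrite lee_fin.
have g0E x : setT x -> (0 <= (g x)%:E)%E by rewrite lee_fin.
have m0E x : setT x -> (0 <= (Num.max (f x) (g x))%:E)%E by rewrite lee_fin.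
have fS10E x : setT x -> (0 <= (f x * S1 x)%:E)%E by rewrite lee_fin.
have fS00E x : setT x -> (0 <= (f x * S0 x)%:E)%E by rewrite lee_fin.
have fg0E x : setT x -> (0 <= (f x)%:E + (g x)%:E)%E by move=> _; rewrite -EFinD lee_fin addr_ge0.
have f20E x : setT x -> (0 <= e^-1%:E * (f x)%:E)%E.
  by move=> _; rewrite mule_ge0 ?lee_fin.
have n20E x : setT x -> (0 <= (2 * e)^-1%:E * (f x * S0 x)%:E)%E.
  by move=> _; rewrite mule_ge0 ?lee_fin.
have p20E x : setT x -> (0 <= (2 * e)^-1%:E * (f x * S1 x)%:E)%E.
  by move=> _; rewrite mule_ge0 ?lee_fin.
have fg20E x : setT x -> (0 <= c%:E * ((f x)%:E + (g x)%:E))%E.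
  by move=> _; apply: mule_ge0; [rewrite lee_fin | exact: fg0E].
have fn0E x : setT x -> (0 <= e^-1%:E * (f x)%:E + (2 * e)^-1%:E * (f x * S0 x)%:E)%E.
  by move=> _; rewrite adde_ge0 ?f20E ?n20E.
have : (\int[mu]_x ((Num.max (f x) (g x))%:E +
    (e^-1%:E * (f x)%:E + (2 * e)^-1%:E * (f x * S0 x)%:E)) <=
        \int[mu]_x (c%:E * ((f x)%:E + (g x)%:E) + (2 * e)^-1%:E * (f x * S1 x)%:E))%E.
  apply: ge0_le_integral => //.
  - by move=> x _; rewrite adde_ge0 ?m0E ?fn0E.
  - exact: emeasurable_funD.
  - exact: emeasurable_funD.
  - by move=> x _; rewrite -!EFinD lee_fin; exact: llr_max_pointwise.
rewrite (ge0_integralD mu measurableT m0E mm fn0E mfn).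
rewrite (ge0_integralD mu measurableT f20E mf2 n20E mn2).
rewrite (ge0_integralD mu measurableT fg20E mfg2 p20E mp2).
rewrite (ge0_integralZl mu measurableT mf f0E) ?lee_fin//.
rewrite (ge0_integralZl mu measurableT mn fS00E) ?lee_fin//.
rewrite (ge0_integralZl mu measurableT mp fS10E) ?lee_fin//.
rewrite (ge0_integralZl mu measurableT mfg fg0E) ?lee_fin//.
rewrite (ge0_integralD mu measurableT f0E mf g0E mg).
rewrite llr_intf llr_intg fS1 fS0.
set I := integral _ _ _ => h.
case: I h => [r| |]//; last first.
  by move=> _; exact: leNye.
rewrite -!EFinM -!EFinD !lee_fin => h.
have h2 : (2 * e)^-1 * (llr_epos D - llr_eneg D) <= (2 * e)^-1 * e ^+ 2.
  by rewrite ler_wpM2l// (le_trans (llr_kappa D)).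
have h3 : (2 * e)^-1 * e ^+ 2 = e / 2 by field; rewrite gt_eqF.
have h4 : (2 * e)^-1 = e^-1 / 2 by field; rewrite gt_eqF.
move: h h2; rewrite h3 /c h4; lra.
Qed.

End llr.

Section contamination.
Local Open Scope classical_set_scope.
Context d (T : measurableType d) (R : realType).

(* The common mixture has density [(1 - e) max f g] plus a constant. *)
Lemma llr_contamination (P Q : probability T R) (kappa e : R) :
  llr_data P Q kappa -> 0 < e -> e <= 1 -> kappa <= e ^+ 2 ->
  exists P' Q' : probability T R, forall A, measurable A ->
    ((1 - e)%:E * P A + e%:E * P' A = (1 - e)%:E * Q A + e%:E * Q' A)%E.
Proof.
move=> D e0 e1 ke; pose mu := llr_mu D; pose f := llr_f D; pose g := llr_g D.
pose h x := Num.max (f x) (g x).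
have mf : measurable_fun setT f by exact: llr_mf.
have mg : measurable_fun setT g by exact: llr_mg.
have mh : measurable_fun setT h by exact: measurable_maxr.
have f0 x : 0 <= f x by rewrite ltW// llr_f0.
have g0 x : 0 <= g x by rewrite ltW// llr_g0.
have h0 x : 0 <= h x by rewrite le_max f0.
have hle := llr_integral_max D e0 ke; rewrite -/mu -/f -/g in hle.
have hfin : (\int[mu]_x (h x)%:E)%E \is a fin_num.
  rewrite ge0_fin_numE; last by apply: integral_ge0 => x _; rewrite lee_fin.
  exact: le_lt_trans hle (ltry _).
pose I := fine (\int[mu]_x (h x)%:E)%E.
have IE : (\int[mu]_x (h x)%:E = I%:E)%E by rewrite fineK.
have Ile : I <= 1 + e by move: hle; rewrite -/h IE lee_fin.
(* [k] is the mass that (1 - e) max f g lacks to be a probability; it is nonnegative because (1 - e)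
   (1 + e) <= 1. *)
pose k := 1 - (1 - e) * I.
have k0 : 0 <= k by rewrite /k; nra.
have ei : 0 <= e^-1 by rewrite invr_ge0 ltW.
have key (r : T -> R) (N : probability T R) : measurable_fun setT r ->
    (forall x, 0 <= r x) -> (forall x, r x <= h x) ->
    (forall A, measurable A -> N A = \int[mu]_(x in A) (r x)%:E)%E ->
  exists N' : probability T R, forall A, measurable A ->
    ((1 - e)%:E * N A + e%:E * N' A =
     (1 - e)%:E * \int[mu]_(x in A) (h x)%:E + k%:E * mu A)%E.
  move=> mr r0 rh NE.
  (* The contaminating density [q] is solved from (1 - e) r + e q = (1 - e) h + k; it is nonnegative
     because [h] dominates [r]. *)
  pose q x := e^-1 * ((1 - e) * (h x - r x) + k).
  have mq : measurable_fun setT q.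
    apply: measurable_funM => //; apply: measurable_funD => //.
    by apply: measurable_funM => //; exact: measurable_funB.
  have q0 x : 0 <= q x.
    by rewrite mulr_ge0// addr_ge0// mulr_ge0 ?subr_ge0.
  have qE A : measurable A -> ((1 - e)%:E * N A + e%:E * \int[mu]_(x in A) (q x)%:E =
     (1 - e)%:E * \int[mu]_(x in A) (h x)%:E + k%:E * mu A)%E.
    move=> mA; rewrite NE//.
    have mrE : measurable_fun A (fun x => (r x)%:E).
      by apply/measurable_EFinP; exact: measurable_funTS.
    have mqE : measurable_fun A (fun x => (q x)%:E).
      by apply/measurable_EFinP; exact: measurable_funTS.
    have mhE : measurable_fun A (fun x => (h x)%:E).
      by apply/measurable_EFinP; exact: measurable_funTS.
    have r0E x : A x -> (0 <= (r x)%:E)%E by rewrite lee_fin.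
    have q0E x : A x -> (0 <= (q x)%:E)%E by rewrite lee_fin.
    have h0E x : A x -> (0 <= (h x)%:E)%E by rewrite lee_fin.
    have e1E : (0 <= (1 - e)%:E)%E by rewrite lee_fin subr_ge0.
    have e0E : (0 <= e%:E)%E by rewrite lee_fin ltW.
    have k0E : (0 <= k%:E)%E by rewrite lee_fin.
    rewrite -(ge0_integralZl mu mA mrE r0E e1E) -(ge0_integralZl mu mA mqE q0E e0E).
    rewrite -(ge0_integralZl mu mA mhE h0E e1E) -integral_cst//.
    rewrite -ge0_integralD//; last 4 first.
    - by move=> x Ax; apply: mule_ge0 => //; exact: r0E.
    - exact: emeasurable_funM.
    - by move=> x Ax; apply: mule_ge0 => //; exact: q0E.
    - exact: emeasurable_funM.
    rewrite -ge0_integralD//; last 2 first.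
    - by move=> x Ax; apply: mule_ge0 => //; exact: h0E.
    - exact: emeasurable_funM.
    apply: eq_integral => x _; rewrite -!EFinM -!EFinD /q; congr EFin.
    by field; rewrite gt_eqF.
  have NT : N setT = 1%E by exact: probability_setT.
  have muT : mu setT = 1%E by exact: probability_setT.
  have q1 : (\int[mu]_x (q x)%:E = 1)%E.
    have := qE setT measurableT; rewrite IE NT muT !mule1.
    case: (integral _ _ _) => [s| |]; last 2 first.
    - by rewrite gt0_muley ?lte_fin.
    - by rewrite gt0_muleNy ?lte_fin.
    rewrite -!EFinM -!EFinD => -[] h1; congr EFin.
    have : e * s = e by move: h1; rewrite /k; lra.
    by move/(congr1 (fun z => e^-1 * z)); rewrite mulKf ?gt_eqF// mulVf ?gt_eqF.
  exists (density_prob mq q0 q1) => A mA.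
  by rewrite -qE// density_probE.
have fh x : f x <= h x by rewrite le_max lexx.
have gh x : g x <= h x by rewrite le_max lexx orbT.
have [P' P'E] := key f P mf f0 fh (llr_Pf D).
have [Q' Q'E] := key g Q mg g0 gh (llr_Qg D).
by exists P', Q' => A mA; rewrite P'E// Q'E.
Qed.

End contamination.

Section llr_tprod.
Local Open Scope classical_set_scope.
Context d (T : measurableType d) (R : realType) (n : nat).
Variables (P Q : 'I_n -> probability T R) (kappa : 'I_n -> R).

Lemma integral_tprod_sum (h : 'I_n -> T -> R) (e : 'I_n -> R) :
  (forall i, measurable_fun setT (h i)) -> (forall i x, 0 <= h i x) ->
  (forall i, \int[P i]_x (h i x)%:E = (e i)%:E)%E ->
  (\int[tprod P]_x (\sum_i h i (tnth x i))%:E = (\sum_i e i)%:E)%E.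
Proof.
move=> mh h0 he; under eq_integral do rewrite -sumEFin.
rewrite ge0_integral_sum//; last 2 first.
- move=> i; apply/measurable_EFinP.
  by apply: measurableT_comp => //; exact: measurable_tnth.
- by move=> i x _; rewrite lee_fin.
rewrite -sumEFin; apply: eq_bigr => i _; rewrite -he.
apply: (integral_tprod_tnth P i (g := fun x => (h i x)%:E)).
  exact/measurable_EFinP.
by move=> x; rewrite lee_fin.
Qed.

Lemma measurable_tprod_prod (h : 'I_n -> T -> R) :
  (forall i, measurable_fun setT (h i)) ->
  measurable_fun setT (fun x : n.-tuple T => \prod_i h i (tnth x i)).
Proof.
move=> mh; apply: measurable_prod => i _.
by apply: measurableT_comp => //; exact: measurable_tnth.
Qed.

Lemma measurable_tprod_sum (h : 'I_n -> T -> R) :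
  (forall i, measurable_fun setT (h i)) ->
  measurable_fun setT (fun x : n.-tuple T => \sum_i h i (tnth x i)).
Proof.
move=> mh; apply: measurable_sum => i.
by apply: measurableT_comp => //; exact: measurable_tnth.
Qed.

(** Log-likelihood ratios of independent coordinates add. With positive and negative parts kept
    apart, all the means involved are integrals of nonnegative functions. *)
Lemma llr_tprod : (forall i, llr_data (P i) (Q i) (kappa i)) ->
  llr_data (tprod P) (tprod Q) (\sum_i kappa i).
Proof.
move=> D; pose mu := tprod (fun i => llr_mu (D i)).
apply: (@LlrData _ _ _ _ _ _ mu
  (fun x => \prod_i llr_f (D i) (tnth x i)) (fun x => \prod_i llr_g (D i) (tnth x i))
  (fun x => \sum_i llr_pos (D i) (tnth x i)) (fun x => \sum_i llr_neg (D i) (tnth x i))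
  (\sum_i llr_epos (D i)) (\sum_i llr_eneg (D i))).
- by apply: (measurable_tprod_prod (h := fun i => llr_f (D i))) => i; exact: llr_mf.
- by apply: (measurable_tprod_prod (h := fun i => llr_g (D i))) => i; exact: llr_mg.
- by apply: (measurable_tprod_sum (h := fun i => llr_pos (D i))) => i; exact: llr_mpos.
- by apply: (measurable_tprod_sum (h := fun i => llr_neg (D i))) => i; exact: llr_mneg.
- by move=> x; apply: prodr_gt0 => i _; exact: llr_g0.
- by move=> x; apply: sumr_ge0 => i _; exact: llr_pos0.
- by move=> x; apply: sumr_ge0 => i _; exact: llr_neg0.
- move=> x; rewrite -sumrB expR_sum -big_split/=.
  by apply: eq_bigr => i _; exact: llr_fE.
- move=> A mA; apply: (@tprod_density _ _ _ n _ _ (fun i => llr_f (D i))) => //.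
  + by move=> i; exact: llr_mf.
  + by move=> i x; rewrite ltW ?llr_f0.
  + by move=> i B; exact: llr_Pf.
- move=> A mA; apply: (@tprod_density _ _ _ n _ _ (fun i => llr_g (D i))) => //.
  + by move=> i; exact: llr_mg.
  + by move=> i x; rewrite ltW ?llr_g0.
  + by move=> i B; exact: llr_Qg.
- apply: (integral_tprod_sum (h := fun i => llr_pos (D i))) => [i|i x|i].
  + exact: llr_mpos.
  + exact: llr_pos0.
  + exact: llr_Epos.
- apply: (integral_tprod_sum (h := fun i => llr_neg (D i))) => [i|i x|i].
  + exact: llr_mneg.
  + exact: llr_neg0.
  + exact: llr_Eneg.
- by rewrite -sumrB; apply: ler_sum => i _; exact: llr_kappa.
Qed.

End llr_tprod.

Section llr_mono.
Context d (T : measurableType d) (R : realType).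
Variables (P Q : probability T R).

Lemma llr_mono (k k' : R) : k <= k' -> llr_data P Q k -> llr_data P Q k'.
Proof.
move=> kk' [mu f g S1 S0 e1 e0 h1 h2 h3 h4 h5 h6 h7 h8 h9 h10 h11 h12 h13].
by apply: (@LlrData _ _ _ _ _ _ mu f g S1 S0 e1 e0) => //; exact: le_trans kk'.
Qed.

End llr_mono.

(** * Projection distance and divergence between spiked Gaussian laws *)

Section frobenius.
Context {R : realType}.

Lemma frobenius_norm_sqr (p q : nat) (A : 'M[R]_(p, q)) :
  frobenius_norm A ^+ 2 = \sum_i \sum_j A i j ^+ 2.
Proof.
by rewrite sqr_sqrtr// sumr_ge0// => i _; rewrite sumr_ge0// => j _; exact: sqr_ge0.
Qed.

Lemma frobenius_tr (p q : nat) (A : 'M[R]_(p, q)) :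
  frobenius_norm A ^+ 2 = \tr (A *m A^T).
Proof.
rewrite frobenius_norm_sqr; apply: eq_bigr => i _; rewrite mxE.
by apply: eq_bigr => j _; rewrite mxE expr2.
Qed.

(** Both projections are idempotent of trace K, so only the trace of their product remains. *)
Lemma proj_dist_sqr (d K : nat) (U V : 'M[R]_(d, K)) :
  orthonormal_columns U -> orthonormal_columns V ->
  proj_dist U V ^+ 2 = 2 * (K%:R - frobenius_norm (U^T *m V) ^+ 2).
Proof.
move=> oU oV; rewrite /proj_dist !frobenius_tr.
have symU : (U *m U^T)^T = U *m U^T by rewrite trmx_mul trmxK.
have symV : (V *m V^T)^T = V *m V^T by rewrite trmx_mul trmxK.
have -> : (U *m U^T - V *m V^T)^T = U *m U^T - V *m V^T by rewrite raddfB/= symU symV.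
rewrite mulmxBl !mulmxBr.
have trB (A B : 'M[R]_d) : \tr (A - B) = \tr A - \tr B by exact: raddfB.
rewrite !trB.
have tt (W : 'M[R]_(d, K)) : orthonormal_columns W ->
    \tr (W *m W^T *m (W *m W^T)) = K%:R.
  move=> oW; rewrite mulmxA -(mulmxA W) oW mulmx1 mxtrace_mulC oW mxtrace1//.
have tx : \tr (U *m U^T *m (V *m V^T)) = \tr (U^T *m V *m (U^T *m V)^T).
  by rewrite trmx_mul trmxK mulmxA -(mulmxA U) -(mulmxA U) mxtrace_mulC !mulmxA.
have tx' : \tr (V *m V^T *m (U *m U^T)) = \tr (U^T *m V *m (U^T *m V)^T).
  by rewrite mxtrace_mulC.
rewrite !tt// tx' tx; ring.
Qed.

End frobenius.

Section llr_spiked.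
Local Open Scope classical_set_scope.
Context {R : realType}.
Variables (d K : nat) (sigma : R).
Hypothesis sigma0 : 0 <= sigma.

(** Under the law of [V], the score along the column w_k of [W] has second moment (1 + sigma |V^T
    w_k|^2) times [std_var]; the sum over k produces the Frobenius norm. *)
Lemma integral_spiked_scores (V W : 'M[R]_(d, K)) :
  orthonormal_columns V -> orthonormal_columns W ->
  (\int[spiked sigma V]_x (\sum_k (sigma * score W k x ^+ 2 / (2 * (1 + sigma))))%:E =
  (sigma / (2 * (1 + sigma)) *
    (K%:R + sigma * frobenius_norm (V^T *m W) ^+ 2) * fine (@std_var R))%:E)%E.
Proof.
move=> oV oW; pose c := sigma / (2 * (1 + sigma)).
have c0 : 0 <= c by rewrite divr_ge0// mulr_ge0// addr_ge0.
have vE : @std_var R = (fine (@std_var R))%:E.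
  rewrite fineK// ge0_fin_numE; last by apply: integral_ge0 => x _; rewrite lee_fin sqr_ge0.
  exact: le_lt_trans (std_var_le) (ltry _).
have ms k : measurable_fun setT (fun x => (score W k x ^+ 2)%:E).
  by apply/measurable_EFinP; apply: measurable_funX; exact: measurable_score.
transitivity (\int[spiked sigma V]_x \sum_k (c%:E * (score W k x ^+ 2)%:E))%E.
  apply: eq_integral => x _; rewrite -sumEFin; apply: eq_bigr => k _.
  by rewrite -EFinM; congr EFin; rewrite /c mulrAC.
rewrite ge0_integral_sum//; last 2 first.
- by move=> k; apply: emeasurable_funM.
- by move=> k x _; rewrite mule_ge0// lee_fin// sqr_ge0.
have -> : (\sum_(k < K) \int[spiked sigma V]_x (c%:E * (score W k x ^+ 2)%:E) =
   \sum_(k < K) (c * (((row k W^T) *m spiked_cov sigma V *m (row k W^T)^T) 0 0 *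
      fine (@std_var R)))%:E)%E.
  apply: eq_bigr => k _; rewrite ge0_integralZl//; last first.
    by move=> x _; rewrite lee_fin sqr_ge0.
  rewrite [RHS]EFinM; congr (_ * _)%E.
  rewrite [RHS]EFinM -vE -(integral_spiked_sqr V sigma0); apply: eq_integral => x _.
  congr (_ ^+ 2)%:E; apply: eq_bigr => i _; by rewrite !mxE.
rewrite sumEFin -mulr_sumr -mulr_suml mulrA; congr (_ * _ * _)%:E.
under eq_bigr do rewrite spiked_cov_quad.
rewrite big_split/= addrC; congr (_ + _).
  transitivity (\sum_(k < K) (W^T *m W) k k).
    by apply: eq_bigr => k _; rewrite mxE; apply: eq_bigr => i _; rewrite !mxE expr2.
  by rewrite oW -/(\tr _) mxtrace1.
rewrite -mulr_sumr frobenius_norm_sqr exchange_big; congr (_ * _).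
apply: eq_bigr => k _; apply: eq_bigr => i _; congr (_ ^+ 2).
rewrite -[in RHS](trmxK (V^T *m W)) mxE trmx_mul trmxK !mxE.
by apply: eq_bigr => j _; rewrite !mxE.
Qed.

(** The two densities share their normalising constant, so the log-likelihood ratio is a difference
    of two nonnegative quadratic forms. Their means differ by sigma^2 / (2 (sigma + 1)) times
    [std_var] times half of the squared distance, and [std_var] is at most 6. *)
Lemma llr_spiked (V W : 'M[R]_(d, K)) :
  orthonormal_columns V -> orthonormal_columns W ->
  llr_data (spiked sigma V) (spiked sigma W)
    (3 / 2 * (sigma ^+ 2 / (sigma + 1)) * proj_dist V W ^+ 2).
Proof.
move=> oV oW.
have s1 : 0 < 1 + sigma by rewrite ltr_wpDr.
have s0 (k : 'I_K) (U : 'M[R]_(d, K)) x : 0 <= sigma * score U k x ^+ 2 / (2 * (1 + sigma)).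
  apply: divr_ge0; first by apply: mulr_ge0 => //; exact: sqr_ge0.
  by apply: mulr_ge0 => //; exact: ltW.
have ms (U : 'M[R]_(d, K)) : measurable_fun setT
    (fun x => \sum_k (sigma * score U k x ^+ 2 / (2 * (1 + sigma)))).
  apply: measurable_sum => k; apply: measurable_funM => //.
  by apply: measurable_funM => //; apply: measurable_funX; exact: measurable_score.
apply: (@LlrData _ _ _ _ _ _ (tprod (fun _ => @std R)) (spike_dens sigma V) (spike_dens sigma W)
  (fun x => \sum_k (sigma * score V k x ^+ 2 / (2 * (1 + sigma))))
  (fun x => \sum_k (sigma * score W k x ^+ 2 / (2 * (1 + sigma)))) _ _
  _ _ _ _ _ _ _ _ _ _
  (integral_spiked_scores oV oV) (integral_spiked_scores oV oW)).
- exact: measurable_spike_dens.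
- exact: measurable_spike_dens.
- exact: ms.
- exact: ms.
- exact: spike_dens_gt0.
- by move=> x; apply: sumr_ge0.
- by move=> x; apply: sumr_ge0.
- move=> x; rewrite /spike_dens -sumrB expR_sum -big_split/=.
  by apply: eq_bigr => k _; rewrite -[RHS]mulrA -expRD addrCA subrr addr0.
- by move=> A; exact: spiked_density.
- by move=> A; exact: spiked_density.
- rewrite oV -[frobenius_norm 1%:M ^+ 2]/(frobenius_norm (1%:M : 'M[R]_K) ^+ 2).
  rewrite frobenius_tr mul1mx trmx1 mxtrace1 (proj_dist_sqr oV oW).
  set F := frobenius_norm _ ^+ 2.
  have FK : 0 <= K%:R - F.
    have := sqr_ge0 (proj_dist V W); rewrite (proj_dist_sqr oV oW) -/F.
    by rewrite pmulr_rge0.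
  have v6 : fine (@std_var R) <= 6.
    rewrite -lee_fin fineK ?std_var_le// ge0_fin_numE; last first.
      by apply: integral_ge0 => x _; rewrite lee_fin sqr_ge0.
    exact: le_lt_trans (std_var_le) (ltry _).
  set v := fine _ in v6 *.
  have -> : sigma / (2 * (1 + sigma)) * (K%:R + sigma * K%:R) * v -
     sigma / (2 * (1 + sigma)) * (K%:R + sigma * F) * v =
     (sigma ^+ 2 / (sigma + 1)) * (K%:R - F) * (v / 2).
    by field; rewrite ?gt_eqF// addrC.
  have -> : 3 / 2 * (sigma ^+ 2 / (sigma + 1)) * (2 * (K%:R - F)) =
     (sigma ^+ 2 / (sigma + 1)) * (K%:R - F) * (6 / 2) by lra.
  apply: ler_wpM2l; last lra.
  by rewrite mulr_ge0// divr_ge0 ?sqr_ge0// addr_ge0.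
Qed.

End llr_spiked.

(** * Product laws in the model *)

Section model_law.
Local Open Scope classical_set_scope.
Context {R : realType}.
Variables (n m d K : nat) (delta eps sigma : R).
Hypothesis sigma0 : 0 <= sigma.

Definition obs_law (V : 'M[R]_(d, K)) : probability (n.-tuple (d.-tuple R)) R :=
  tprod (fun _ : 'I_n => spiked sigma V).

Variables (nu : 'I_m -> probability (n.-tuple (d.-tuple R)) R).
Variables (S : {set 'I_m}) (V : 'I_m -> 'M[R]_(d, K)).
Hypothesis nuE : forall i, i \in S -> nu i = obs_law (V i).

Let P : probability (sample R n m d) R := tprod nu.

Lemma row_of_obs_law i (j : 'I_n) A : i \in S -> measurable A ->
  P (row_of_obs i j @^-1` A) = spiked sigma (V i) A.
Proof.
move=> iS mA.
have mB : measurable ((fun x : n.-tuple (d.-tuple R) => tnth x j) @^-1` A).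
  by rewrite -[X in measurable X]setTI; exact: measurable_tnth.
rewrite -[LHS]/(tprod nu ((fun x => tnth x i) @^-1` ((fun x => tnth x j) @^-1` A))).
by rewrite tprod_preimage// nuE// /obs_law tprod_preimage.
Qed.

Lemma in_model_tprod :
  (forall i, i \in S -> orthonormal_columns (V i)) ->
  (forall i j, i \in S -> j \in S -> proj_dist (V i) (V j) <= delta) ->
  #|(~: S)%SET|%:R <= eps * m%:R ->
  in_model delta eps sigma P S V.
Proof.
move=> oV close card; split => //.
- exact: tprod_mutually_independent.
- move=> i iS J A JT mA.
  have mB j : j \in J ->
      measurable ((fun x : n.-tuple (d.-tuple R) => tnth x j) @^-1` A j).
    by move=> jJ; rewrite -[X in measurable X]setTI; apply: measurable_tnth => //; exact: mA.
  transitivity (tprod nu ((fun x => tnth x i) @^-1`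
      (\bigcap_(j in [set` J]) ((fun x : n.-tuple (d.-tuple R) => tnth x j) @^-1` A j)))).
    by [].
  rewrite tprod_preimage; last first.
    by apply: fin_bigcap_measurable => [|j /= jJ]; [exact: finite_finset|exact: mB].
  rewrite nuE// /obs_law tprod_bigcap//.
  by apply: eq_bigr => j jJ; rewrite row_of_obs_law//; exact: mA.
- move=> i iS j a B mB.
  have mC : measurable [set x : d.-tuple R | B (\sum_k a 0 k * tnth x k)].
    by have := measurable_lincomb (fun k => a 0 k) measurableT mB; rewrite setTI.
  by rewrite -spiked_gaussian// -(row_of_obs_law j iS mC).
- apply: tprod_independent_subfamilies => i; rewrite finset.in_setC.
  by case: (i \in S).
Qed.

End model_law.

(** * Packing and frames *)

Section frobenius_col.
Context {R : realType}.

Lemma frobenius_trT (p q : nat) (A : 'M[R]_(p, q)) :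
  frobenius_norm A ^+ 2 = \tr (A^T *m A).
Proof. by rewrite frobenius_tr mxtrace_mulC. Qed.

Lemma frobenius_row_mx (p q1 q2 : nat) (A : 'M[R]_(p, q1)) (B : 'M[R]_(p, q2)) :
  frobenius_norm (row_mx A B) ^+ 2 = frobenius_norm A ^+ 2 + frobenius_norm B ^+ 2.
Proof. by rewrite !frobenius_tr tr_row_mx mul_row_col raddfD. Qed.

Lemma frobenius_sub_row_mx (p q1 q2 : nat) (M : 'M[R]_(p, q1 + q2)) A B :
  frobenius_norm (M - row_mx A B) ^+ 2 =
  frobenius_norm (lsubmx M - A) ^+ 2 + frobenius_norm (rsubmx M - B) ^+ 2.
Proof.
by rewrite -[in LHS](hsubmxK M) opp_row_mx add_row_mx frobenius_row_mx.
Qed.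

(** Pythagoras for the projection [Q Q^T]. *)
Lemma frobenius_isometry_tr (p q r : nat) (Q : 'M[R]_(p, q)) (A : 'M[R]_(p, r)) :
  orthonormal_columns Q -> frobenius_norm (Q^T *m A) ^+ 2 <= frobenius_norm A ^+ 2.
Proof.
move=> oQ; rewrite -subr_ge0.
have -> : frobenius_norm A ^+ 2 - frobenius_norm (Q^T *m A) ^+ 2 =
    frobenius_norm (A - Q *m (Q^T *m A)) ^+ 2.
  rewrite !frobenius_trT.
  have -> : (A - Q *m (Q^T *m A))^T *m (A - Q *m (Q^T *m A)) =
      A^T *m A - (Q^T *m A)^T *m (Q^T *m A).
    have -> : (A - Q *m (Q^T *m A))^T = A^T - (Q *m (Q^T *m A))^T.
      by apply/matrixP => i j; rewrite !mxE.
    rewrite mulmxBl !mulmxBr !trmx_mul trmxK !mulmxA.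
    rewrite -(mulmxA (A^T *m Q) Q^T Q) oQ mulmx1.
    by rewrite -!mulmxA !mulmxA subrr subr0.
  by rewrite raddfB.
exact: sqr_ge0.
Qed.

Lemma ex_unit_orthogonal (p q : nat) (A : 'M[R]_(p, q)) : (q < p)%N ->
  exists v : 'cV[R]_p, v^T *m v = 1%:M /\ v^T *m A = 0.
Proof.
move=> qp.
have /rowV0Pn[v vA v0] : kermx A != 0.
  rewrite -mxrank_eq0 mxrank_ker -lt0n subn_gt0.
  exact: leq_ltn_trans (rank_leq_col A) qp.
move/sub_kermxP: vA => vA.
pose N := \sum_i v 0 i ^+ 2.
have N0 : 0 < N.
  rewrite lt_neqAle sumr_ge0 ?andbT => [|i _]; last exact: sqr_ge0.
  apply: contra v0; rewrite eq_sym => /eqP; rewrite /N => /psumr_eq0P h.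
  apply/eqP/rowP => i; rewrite mxE; apply/eqP.
  by rewrite -sqrf_eq0 h// => j _; exact: sqr_ge0.
have tZ : ((Num.sqrt N)^-1 *: v^T)^T = (Num.sqrt N)^-1 *: v by rewrite linearZ/= trmxK.
exists ((Num.sqrt N)^-1 *: v^T); rewrite tZ; split; last first.
  by rewrite -scalemxAl vA scaler0.
rewrite -scalemxAl -scalemxAr scalerA -invfM -expr2 sqr_sqrtr ?ltW//.
apply/matrixP => i j; rewrite !mxE !ord1 /=.
under eq_bigr do rewrite mxE -expr2.
by rewrite -/N mulVf// gt_eqF.
Qed.

Lemma ex_isometry_orthogonal (p q b : nat) (A : 'M[R]_(p, q)) : (q + b <= p)%N ->
  exists Q : 'M[R]_(p, b), orthonormal_columns Q /\ Q^T *m A = 0.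
Proof.
elim: b => [|b IH] qb.
  exists 0; split; first by rewrite /orthonormal_columns thinmx0 flatmx0; apply/esym/flatmx0.
  by rewrite trmx0 mul0mx.
have [|Q [oQ QA]] := IH; first by apply: leq_trans qb; rewrite addnS.
have [|v [vv vAQ]] := @ex_unit_orthogonal p (q + b) (row_mx A Q).
  by rewrite -addnS.
move: vAQ; rewrite mul_mx_row => /eqP; rewrite row_mx_eq0 => /andP[/eqP vA /eqP vQ].
exists (row_mx v Q : 'M[R]_(p, 1 + b)); split.
  change ((row_mx v Q)^T *m row_mx v Q = 1%:M :> 'M[R]_(1 + b)).
  rewrite tr_row_mx mul_col_row vv vQ oQ.
  have -> : Q^T *m v = 0 by rewrite -[LHS]trmxK trmx_mul trmxK vQ trmx0.
  by rewrite -scalar_mx_block.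
change ((row_mx v Q)^T *m A = 0 :> 'M[R]_(1 + b, q)).
by rewrite tr_row_mx mul_col_mx vA QA col_mx0.
Qed.

End frobenius_col.

Section signs.
Context {R : realType}.
Variable b : nat.
Hypothesis b0 : (0 < b)%N.
Local Notation B := {ffun 'I_b -> bool}.

Definition signs (z : B) : 'cV[R]_b := \col_k ((-1) ^+ (z k) / Num.sqrt b%:R).

Lemma signs_unit z : (signs z)^T *m signs z = 1%:M.
Proof.
have b0R : b%:R != 0 :> R by rewrite pnatr_eq0 -lt0n.
apply/matrixP => i j; rewrite !mxE !ord1 /=.
under eq_bigr => k _.
  rewrite !mxE -expr2 exprMn sqrr_sign mul1r exprVn sqr_sqrtr ?ler0n//.
  over.
by rewrite sumr_const card_ord -[LHS]mulr_natr mulVf.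
Qed.

Definition decode (m : 'cV[R]_b) : B := [ffun k => m k 0 < 0].

Definition hamming (z z' : B) : nat := \sum_k (z k != z' k).

(** A wrongly decoded sign means that the entry of [m] is at least [1 / sqrt b] away from that of
    [signs z], so it costs 1 / b in squared distance. *)
Lemma hamming_signs z (m : 'cV[R]_b) :
  (hamming z (decode m))%:R / b%:R <= frobenius_norm (m - signs z) ^+ 2.
Proof.
rewrite frobenius_norm_sqr /hamming natr_sum mulr_suml; apply: ler_sum => k _.
rewrite big_ord1 !mxE ffunE.
have b1 : 0 < (Num.sqrt b%:R)^-1 :> R by rewrite invr_gt0 sqrtr_gt0 ltr0n.
have b2 : b%:R^-1 = (Num.sqrt b%:R)^-1 ^+ 2 :> R by rewrite exprVn sqr_sqrtr ?ler0n.
rewrite b2; set r := (Num.sqrt _)^-1 in b1 *.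
case: (z k); case: ltP => h; rewrite ?eqxx/= ?mul0r ?sqr_ge0// mul1r.
- by rewrite expr1 mulN1r opprK; nra.
- by rewrite expr0 mul1r; nra.
Qed.

(** The generating function of the Hamming distance factorises over the coordinates, whatever the
    centre [z']; through Chernoff's bound it stands in for the volume of Hamming balls. *)
Lemma sum_hamming (z' : B) (x : R) : \sum_z x ^+ hamming z z' = (1 + x) ^+ b.
Proof.
under eq_bigr do rewrite /hamming -prodrXr.
rewrite -(bigA_distr_bigA (fun k (y : bool) => x ^+ (y != z' k))).
rewrite (eq_bigr (fun _ => 1 + x)); last first.
  by move=> k _; rewrite big_bool; case: (z' k); rewrite /= !expr0 !expr1 // addrC.
by rewrite prodr_const card_ord.
Qed.

End signs.

Section packing.
Context {R : realType}.
Variables (p b : nat).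
Hypothesis b0 : (0 < b)%N.

(* Column [j + 1] is a sign vector transported by an isometry into the
   orthogonal complement of the previous columns; hence given the previous
   columns its signs can be read off one at a time, and errors of a decoder
   are counted column after column. *)
Lemma packing (K : nat) : (K + b <= p.+1)%N ->
  exists (W : finType) (U : W -> 'M[R]_(p, K)),
    [/\ #|W| = ((2 ^ b) ^ K)%N, forall w, orthonormal_columns (U w) &
        forall M : 'M[R]_(p, K), exists H : W -> nat,
          (forall w, (H w)%:R / b%:R <= frobenius_norm (M - U w) ^+ 2) /\
          (forall x : R, \sum_w x ^+ H w = ((1 + x) ^+ b) ^+ K)].
Proof.
elim: K => [|K IH] Kb.
  exists unit, (fun _ => 0); split.
  - by rewrite card_unit expn0.
  - by move=> w; rewrite /orthonormal_columns thinmx0 flatmx0; apply/esym/flatmx0.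
  - move=> M; exists (fun _ => 0%N); split => [w|x]; first by rewrite mul0r sqr_ge0.
    by rewrite big_const card_unit /= addr0 !expr0.
have [|W [U [cW oU hU]]] := IH; first by rewrite (leq_trans _ Kb)// leq_add2r.
(* The K previous columns must leave b free dimensions in R^p, that is K + b <= p, which for K + 1
   columns is the hypothesis with [p.+1]. *)
have /choice[Q hQ] : forall w, exists Q : 'M[R]_(p, b),
    orthonormal_columns Q /\ Q^T *m U w = 0.
  by move=> w; apply: ex_isometry_orthogonal.
exists (W * {ffun 'I_b -> bool})%type.
exists (fun w => row_mx (Q w.1 *m signs w.2) (U w.1) : 'M[R]_(p, 1 + K)); split.
- by rewrite card_prod cW card_ffun card_bool card_ord expnSr.
- move=> [w z] /=; have [oQ QU] := hQ w.
  change ((row_mx (Q w *m signs z) (U w))^T *m row_mx (Q w *m signs z) (U w) =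
    1%:M :> 'M[R]_(1 + K)).
  rewrite tr_row_mx mul_col_row.
  rewrite trmx_mul -!mulmxA QU !mulmx0 (mulmxA (Q w)^T) oQ mul1mx signs_unit// oU.
  have -> : (U w)^T *m (Q w *m signs z) = 0.
    by rewrite mulmxA -[_^T *m _]trmxK trmx_mul trmxK QU trmx0 mul0mx.
  by rewrite -scalar_mx_block.
- move=> M; have [H [H1 H2]] := hU (rsubmx (M : 'M[R]_(p, 1 + K))).
  pose m := lsubmx (M : 'M[R]_(p, 1 + K)).
  exists (fun w => (H w.1 + hamming w.2 (decode ((Q w.1)^T *m m)))%N); split.
    move=> [w z] /=; have [oQ QU] := hQ w.
    rewrite [leRHS](frobenius_sub_row_mx (q1:=1) (q2:=K) M (Q w *m signs z) (U w)).
    rewrite natrD mulrDl addrC; apply: lerD; last exact: H1.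
    apply: le_trans (hamming_signs b0 z _) _.
    apply: le_trans (frobenius_isometry_tr _ oQ).
    by rewrite mulmxBr mulmxA oQ mul1mx.
  (* For a fixed [w] the decoded word no longer depends on [z], so summing over [z] first gives the
     full factor (1 + x)^b. *)
  move=> x; rewrite -(pair_bigA _ (fun w z => x ^+ (H w + hamming z (decode ((Q w)^T *m m))))) /=.
  under eq_bigr do under eq_bigr do rewrite exprD.
  under eq_bigr do rewrite -mulr_sumr sum_hamming.
  by rewrite -mulr_suml H2 exprSr.
Qed.

End packing.

Section frame.
Context {R : realType}.
Variables (K p : nat).
Implicit Types (U W : 'M[R]_(p, K)) (c s : R).

(** The identity block pins down the basis of the subspace: the lower left block of the projection
    is then [c s U], with no rotation left to quotient out. *)
Definition frame c s U : 'M[R]_(K + p, K) := col_mx c%:M (s *: U).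

Lemma frame_gram c s c' s' U : orthonormal_columns U ->
  (frame c s U)^T *m frame c' s' U = (c * c' + s * s')%:M.
Proof.
move=> oU; rewrite /frame tr_col_mx mul_row_col tr_scalar_mx -scalar_mxM.
have -> : (s *: U)^T = s *: U^T by rewrite linearZ.
by rewrite -scalemxAl -scalemxAr scalerA oU scalemx1 -raddfD.
Qed.

Lemma frame_orthonormal c s U : orthonormal_columns U -> c ^+ 2 + s ^+ 2 = 1 ->
  orthonormal_columns (frame c s U).
Proof. by move=> oU cs; rewrite /orthonormal_columns frame_gram// -!expr2 cs. Qed.

Lemma frobenius_scalar_mx (a : R) : frobenius_norm (a%:M : 'M[R]_K) ^+ 2 = K%:R * a ^+ 2.
Proof.
rewrite frobenius_tr tr_scalar_mx -scalar_mxM mxtrace_scalar expr2.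
by rewrite [RHS]mulr_natl.
Qed.

Lemma frame_dist c s c' s' U : orthonormal_columns U ->
  c ^+ 2 + s ^+ 2 = 1 -> c' ^+ 2 + s' ^+ 2 = 1 ->
  proj_dist (frame c s U) (frame c' s' U) ^+ 2 =
  2 * K%:R * (1 - (c * c' + s * s') ^+ 2).
Proof.
move=> oU cs cs'; rewrite proj_dist_sqr; try exact: frame_orthonormal.
by rewrite frame_gram// frobenius_scalar_mx; ring.
Qed.

Lemma frame0 c U W : frame c 0 U = frame c 0 W.
Proof. by rewrite /frame !scale0r. Qed.

Lemma frobenius_dlsubmx (M : 'M[R]_(K + p, K + p)) :
  frobenius_norm (dlsubmx M) ^+ 2 <= frobenius_norm M ^+ 2.
Proof.
rewrite !frobenius_norm_sqr [leRHS]big_split_ord/= ler_wpDl//.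
  by apply: sumr_ge0 => i _; apply: sumr_ge0 => j _; exact: sqr_ge0.
apply: ler_sum => i _; rewrite [leRHS]big_split_ord/= ler_wpDr//.
  by apply: sumr_ge0 => j _; exact: sqr_ge0.
by apply: ler_sum => j _; rewrite !mxE.
Qed.

Lemma frame_proj_dlsubmx c s U :
  dlsubmx (frame c s U *m (frame c s U)^T) = (c * s) *: U.
Proof.
rewrite /frame tr_col_mx mul_col_row block_mxKdl tr_scalar_mx.
by rewrite -scalemxAl mul_mx_scalar scalerA mulrC.
Qed.

Lemma frobenius_norm_ge0 (q r : nat) (A : 'M[R]_(q, r)) : 0 <= frobenius_norm A.
Proof. exact: sqrtr_ge0. Qed.

Lemma frobenius_scale (q r : nat) (a : R) (A : 'M[R]_(q, r)) :
  frobenius_norm (a *: A) ^+ 2 = a ^+ 2 * frobenius_norm A ^+ 2.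
Proof.
rewrite !frobenius_norm_sqr mulr_sumr; apply: eq_bigr => i _.
by rewrite mulr_sumr; apply: eq_bigr => j _; rewrite mxE exprMn.
Qed.

(** The rescaled lower left block of the estimated projection is an estimate of [U], whose error is
    controlled by the loss; [packing] applies to this block. *)
Lemma frame_loss c s U (V : 'M[R]_(K + p, K)) : c * s != 0 ->
  (c * s) ^+ 2 * frobenius_norm ((c * s)^-1 *: dlsubmx (V *m V^T) - U) ^+ 2 <=
  proj_dist V (frame c s U) ^+ 2.
Proof.
move=> cs; rewrite -frobenius_scale scalerBr scalerA mulfV// scale1r.
rewrite -frame_proj_dlsubmx; apply: le_trans (frobenius_dlsubmx _).
rewrite le_eqVlt; apply/orP; left; apply/eqP; congr (frobenius_norm _ ^+ 2).
by apply/matrixP => i j; rewrite !mxE.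
Qed.

(** Two-point separation: [M] cannot be close to both [A] and [B]. The squared form avoids square
    roots in the loss. *)
Lemma frobenius_parallelogram (q r : nat) (A B M : 'M[R]_(q, r)) :
  frobenius_norm (A - B) ^+ 2 <=
  2 * (frobenius_norm (M - A) ^+ 2 + frobenius_norm (M - B) ^+ 2).
Proof.
rewrite !frobenius_norm_sqr -big_split mulr_sumr /=; apply: ler_sum => i _.
rewrite -big_split mulr_sumr /=; apply: ler_sum => j _; rewrite !mxE.
have := sqr_ge0 (2 * M i j - A i j - B i j); nra.
Qed.

End frame.

(** * Measurability of the loss and reductions for the minimax risk *)

Section measurable_loss.
Local Open Scope classical_set_scope.
Context {R : realType} d (T : measurableType d).
Variables (m q K : nat).

Lemma measurable_superlevel (f : T -> R) (u : R) : measurable_fun setT f ->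
  measurable [set x | u <= f x].
Proof.
move=> mf; rewrite -[X in measurable X]setTI.
rewrite -[X in _ `&` X](_ : f @^-1` `[u, +oo[ = _); first exact: mf.
by apply/seteqP; split => x /=; rewrite in_itv/= andbT.
Qed.

Lemma measurable_proj_dist (Vhat : T -> 'M[R]_(q, K)) (V : 'M[R]_(q, K)) :
  (forall k l, measurable_fun setT (fun x => Vhat x k l)) ->
  measurable_fun setT (fun x => proj_dist (Vhat x) V).
Proof.
move=> mV; apply: measurableT_comp.
  by apply: continuous_measurable_fun; exact: sqrt_continuous.
apply: measurable_sum => i; apply: measurable_sum => j.
apply: measurable_funX.
rewrite (_ : (fun x => _) = fun x =>
    (\sum_k Vhat x i k * Vhat x j k) - (V *m V^T) i j); last first.
  apply/funext => x; rewrite mxE [in LHS]mxE; congr (_ + _).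
    by apply: eq_bigr => k _; rewrite mxE.
  by rewrite mxE.
apply: measurable_funB => //; apply: measurable_sum => k.
exact: measurable_funM.
Qed.

Lemma measurable_max_loss (S : {set 'I_m}) (Vhat : 'I_m -> T -> 'M[R]_(q, K))
    (V : 'I_m -> 'M[R]_(q, K)) :
  (forall i k l, measurable_fun setT (fun x => Vhat i x k l)) ->
  measurable_fun setT (fun x => max_loss S (fun i => Vhat i x) V).
Proof.
move=> mV; rewrite /max_loss unlock; elim: (index_enum _) => [|i s IH] /=.
  exact: measurable_cst.
case: (i \in S) => //; apply: measurable_maxr => //.
exact: measurable_proj_dist.
Qed.

Lemma proj_dist_le_max_loss (S : {set 'I_m}) (Vhat V : 'I_m -> 'M[R]_(q, K)) i :
  i \in S -> proj_dist (Vhat i) (V i) <= max_loss S Vhat V.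
Proof.
move=> iS; rewrite /max_loss.
exact: (le_bigmax_cond 0 (fun i => proj_dist (Vhat i) (V i)) iS).
Qed.

End measurable_loss.

Section risk.
Local Open Scope classical_set_scope.
Context {R : realType}.
Variables (n m q K : nat) (delta eps sigma : R).

Lemma le_minimax_risk (t C : R) :
  (forall Vhat : 'I_m -> sample R n m q -> 'M[R]_(q, K), is_estimator Vhat ->
   exists (P : probability (sample R n m q) R) S V,
     in_model delta eps sigma P S V /\
     (C%:E <= P [set x | (t <= max_loss S (fun i => Vhat i x) V)%R])%E) ->
  (C%:E <= minimax_risk n m q K delta eps sigma t)%E.
Proof.
move=> h; apply: le_ereal_inf_tmp => _ [Vhat eV <-].
have [P [S [V [PM CP]]]] := h Vhat eV.
apply: le_trans CP _; apply: ereal_sup_ubound.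
by exists P, S, V.
Qed.

Lemma minimax_risk_anti (t t' : R) : t <= t' ->
  (minimax_risk n m q K delta eps sigma t' <= minimax_risk n m q K delta eps sigma t)%E.
Proof.
move=> tt'; apply: le_ereal_inf_tmp => _ [Vhat eV <-].
apply: (@le_trans _ _ (worst_case_risk delta eps sigma t' Vhat)).
  by apply: ereal_inf_lbound; exists Vhat.
apply: ge_ereal_sup => _ [P [S [V [PM ->]]]].
apply: (@le_trans _ _ (P [set x | (t <= max_loss S (fun i => Vhat i x) V)%R])); last first.
  by apply: ereal_sup_ubound; exists P, S, V.
  have mL := measurable_max_loss S V (estimator_measurable eV).
  have mS u := measurable_superlevel u mL.
  apply: le_measure; rewrite ?inE; [exact: mS|exact: mS|].
  by move=> x /=; exact: le_trans.
Qed.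

End risk.

(** * Fano's method *)

Section fano.
Local Open Scope classical_set_scope.
Context d (T : measurableType d) (R : realType) (W : finType).

(** [p] bounds the fraction of the family that one observation can serve, so the average of Q (G w)
    is at most [p]; changing measure from [Q] to [P w] for a below-average [w] concludes. The sets
    [G w] may overlap. *)
Lemma fano (P : W -> probability T R) (Q : probability T R) (kappa : R)
    (D : forall w, llr_data (P w) Q kappa) (G : W -> set T) (p l : R) :
  (0 < #|W|)%N -> 0 < l -> (forall w, measurable (G w)) ->
  (forall x, \sum_w \1_(G w) x <= #|W|%:R * p) ->
  exists w, (P w (G w) <= (expR l * p + (kappa + 1) / l)%:E)%E.
Proof.
move=> W0 l0 mG hp; apply: contrapT => /forallNP hn.
have W0R : 0 < #|W|%:R :> R by rewrite ltr0n.
have sQ : (\sum_w Q (G w) <= (#|W|%:R * p)%:E)%E.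
  under eq_bigr do rewrite -(integral_indic_setT Q (mG _)).
  rewrite -ge0_integral_sum//; last first.
    by move=> w; exact/measurable_EFinP/measurable_indic.
  apply: (@le_trans _ _ (\int[Q]_x (cst (#|W|%:R * p)%:E x))%E).
    apply: ge0_le_integral => //.
    - by move=> x _; apply: sume_ge0 => w _; rewrite lee_fin.
    - apply: emeasurable_sum => w; exact/measurable_EFinP/measurable_indic.
    - by move=> x _; rewrite sumEFin lee_fin.
  rewrite integral_cst// -[leRHS]mule1; apply: lee_wpmul2l.
    rewrite lee_fin; have /card_gt0P[w _] := W0.
    by have := hp point; apply: le_trans; apply: sumr_ge0.
  exact: probability_le1.
pose q w := fine (Q (G w)).
have qE w : Q (G w) = (q w)%:E by rewrite fineK// fin_num_measure.
pose r w := fine (P w (G w)).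
have rE w : P w (G w) = (r w)%:E by rewrite fineK// fin_num_measure.
have h1 w : r w <= expR l * q w + (kappa + 1) / l.
  have := llr_change_measure (D w) l0 (mG w).
  by rewrite rE qE -EFinM -EFinD lee_fin.
have h2 w : expR l * p + (kappa + 1) / l < r w.
  by have := hn w => /negP; rewrite -ltNge rE lte_fin.
have h3 : \sum_w q w <= #|W|%:R * p.
  by move: sQ; under eq_bigr do rewrite qE; rewrite sumEFin lee_fin.
have : \sum_(w : W) p < \sum_w q w.
  have /card_gt0P[w0 _] := W0.
  apply: ltr_sum; first by apply/hasP; exists w0 => //; rewrite mem_index_enum.
  move=> w _; have := lt_le_trans (h2 w) (h1 w).
  by rewrite ltrD2r ltr_pM2l ?expR_gt0.
by rewrite sumr_const -mulr_natl ltNge h3.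
Qed.

End fano.

Section count.
Context {R : realType}.

(** Chernoff's bound on the generating function at x = (3/4)^8. The choice works because 1 + (3/4)^8
    <= 2 (3/4)^2. *)
Lemma fano_count (W : finType) (H : W -> nat) (b K : nat) :
  #|W| = ((2 ^ b) ^ K)%N ->
  (forall x : R, \sum_w x ^+ H w = ((1 + x) ^+ b) ^+ K) ->
  \sum_w (8 * H w <= K * b)%N%:R <= #|W|%:R * (3 / 4) ^+ (K * b) :> R.
Proof.
move=> cW hH; pose y : R := 3 / 4.
have y0 : 0 < y by rewrite /y; lra.
have y1 : y <= 1 by rewrite /y; lra.
have yN : 0 < y ^+ (K * b) by exact: exprn_gt0.
have h1 : \sum_w (8 * H w <= K * b)%N%:R * y ^+ (K * b) <= (1 + y ^+ 8) ^+ (K * b).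
  have -> : (1 + y ^+ 8) ^+ (K * b) = \sum_w (y ^+ 8) ^+ H w.
    by rewrite hH mulnC exprM.
  apply: ler_sum => w _; rewrite -exprM.
  case: leqP => h; last by rewrite mul0r exprn_ge0// ltW.
  by rewrite mul1r; apply: ler_wiXn2l => //; exact: ltW.
rewrite -(ler_pM2r yN) mulr_suml; apply: le_trans h1 _.
rewrite cW -expnM natrX [(b * K)%N]mulnC -!exprMn.
apply: lerXn2r; rewrite ?nnegrE; rewrite /y; lra.
Qed.

End count.

Section numeric.
Context {R : realType}.

(** This is the bound of [fano] at l = N / 8. As 3/4 <= exp (- 1/4), the first term is at most exp
    (- N / 8) <= 1/8; the second is at most 1/8 + 8 / N, which is 1/4 once N >= 64. *)
Lemma fano_numeric (N : nat) (kappa : R) : (64 <= N)%N -> kappa <= N%:R / 64 ->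
  expR (N%:R / 8) * (3 / 4) ^+ N + (kappa + 1) / (N%:R / 8) <= 1 / 2.
Proof.
move=> N64 hk; have N64R : 64 <= N%:R :> R by rewrite (ler_nat R 64 N).
have h1 : (3 / 4 : R) ^+ N <= expR (- (N%:R / 4)).
  have -> : - (N%:R / 4) = (- (1 / 4)) * N%:R :> R by field.
  rewrite expRM_natr; apply: lerXn2r; rewrite ?nnegrE ?expR_ge0//.
  by have := expR_ge1Dx (- (1 / 4) : R); lra.
have h2 : expR (N%:R / 8) * (3 / 4) ^+ N <= 1 / 8 :> R.
  apply: (@le_trans _ _ (expR (N%:R / 8) * expR (- (N%:R / 4)))).
    by rewrite ler_wpM2l// expR_ge0.
  rewrite -expRD; have -> : N%:R / 8 + - (N%:R / 4) = - (N%:R / 8) :> R by field.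
  rewrite expRN div1r lef_pV2 ?posrE ?expR_gt0//.
  by have := expR_ge1Dx (N%:R / 8 : R); lra.
have h3 : (kappa + 1) / (N%:R / 8) <= 1 / 4.
  by rewrite ler_pdivrMr; [lra|rewrite divr_gt0//; lra].
lra.
Qed.

End numeric.

Section fano_risk.
Local Open Scope classical_set_scope.
Context {R : realType}.
Variables (n m K p b : nat) (delta eps sigma c s t : R) (i0 : 'I_m) (I0 : {set 'I_m}).
Hypotheses (b0 : (0 < b)%N) (Kb : (K + b <= p.+1)%N) (Kb64 : (64 <= K * b)%N).
Hypotheses (sigma0 : 0 <= sigma) (delta0 : 0 <= delta) (eps0 : 0 <= eps).
Hypotheses (c0 : 0 < c) (s0 : 0 < s) (cs : c ^+ 2 + s ^+ 2 = 1).
Hypothesis i0I0 : i0 \in I0.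
Hypothesis kappa_le : (#|I0| * n)%:R *
  (3 / 2 * (sigma ^+ 2 / (sigma + 1)) * (2 * K%:R * s ^+ 2)) <= (K * b)%:R / 64.
Hypothesis close : I0 = [set: 'I_m]%SET \/ 2 * K%:R * s ^+ 2 <= delta ^+ 2.
Hypotheses (t0 : 0 < t) (t_le : t ^+ 2 <= (c * s) ^+ 2 * (K%:R / 8)).

Lemma proj_dist_self (d : nat) (V : 'M[R]_(d, K)) : proj_dist V V = 0.
Proof.
apply/eqP; rewrite -sqrf_eq0 /proj_dist subrr frobenius_norm_sqr big1// => i _.
by rewrite big1// => j _; rewrite mxE expr0n.
Qed.

Lemma proj_distC (d : nat) (U V : 'M[R]_(d, K)) : proj_dist U V = proj_dist V U.
Proof.
rewrite /proj_dist /frobenius_norm; congr Num.sqrt; apply: eq_bigr => i _.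
by apply: eq_bigr => j _; rewrite !mxE -[in LHS]opprB sqrrN.
Qed.

(** [I0] is the set of sources that carry the unknown frame and [i0] the one where the loss is
    measured; the other sources keep the reference frame [V0]. Taking [s = 0] for the reference puts
    it at equal distance from all hypotheses, so each of the [|I0| n] informative rows contributes
    the same divergence. *)
Lemma fano_risk : ((1 / 2)%:E <= minimax_risk n m (K + p) K delta eps sigma t)%E.
Proof.
have [W [U [cW oU hU]]] := @packing R p b b0 K Kb.
have W0 : (0 < #|W|)%N by rewrite cW !expn_gt0.
have /card_gt0P[w0 _] := W0.
pose V0 := frame 1 0 (U w0).
pose Vw w := frame c s (U w).
pose Vs w (i : 'I_m) := if i \in I0 then Vw w else V0.
have c1 : 1 ^+ 2 + 0 ^+ 2 = 1 :> R by rewrite expr1n expr0n addr0.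
have oV0 : orthonormal_columns V0 by exact: frame_orthonormal.
have oVw w : orthonormal_columns (Vw w) by exact: frame_orthonormal.
have oVs w i : orthonormal_columns (Vs w i) by rewrite /Vs; case: ifP.
have dV w : proj_dist (Vw w) V0 ^+ 2 = 2 * K%:R * s ^+ 2.
  (* At [s = 0] a frame does not depend on [U], so [V0] can be written with the [U w] that
     [frame_dist] requires. *)
  rewrite /V0 (frame0 1 (U w0) (U w)) frame_dist// mulr0 addr0 mulr1; congr (_ * _).
  by rewrite -cs addrAC subrr add0r.
pose P w : probability (sample R n m (K + p)) R :=
  tprod (fun i => obs_law n sigma (Vs w i)).
pose Q : probability (sample R n m (K + p)) R := tprod (fun _ => obs_law n sigma V0).
pose a := 3 / 2 * (sigma ^+ 2 / (sigma + 1)).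
pose kappa := (#|I0| * n)%:R * (a * (2 * K%:R * s ^+ 2)).
have D w : llr_data (P w) Q kappa.
  apply: (@llr_mono _ _ _ _ _
    (\sum_(i < m) \sum_(j < n) a * proj_dist (Vs w i) V0 ^+ 2)); last first.
    by apply: llr_tprod => i; apply: llr_tprod => j; exact: llr_spiked.
  have -> : \sum_(i < m) \sum_(j < n) a * proj_dist (Vs w i) V0 ^+ 2 =
      \sum_(i in I0) (n%:R * (a * (2 * K%:R * s ^+ 2))).
    rewrite [RHS]big_mkcond; apply: eq_bigr => i _.
    rewrite sumr_const card_ord -[LHS]mulr_natl /Vs; case: ifP => _; first by rewrite dV.
    by rewrite proj_dist_self expr0n !mulr0.
  by rewrite sumr_const /kappa natrM -[leLHS]mulr_natl mulrA.
apply: le_minimax_risk => Vhat eV.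
pose G w := [set x : sample R n m (K + p) | proj_dist (Vhat i0 x) (Vw w) < t].
have mG w : measurable (G w).
  have -> : G w = ~` [set x | t <= proj_dist (Vhat i0 x) (Vw w)].
    by apply/seteqP; split => x; rewrite /G/= ltNge => /negP.
  apply: measurableC; apply: measurable_superlevel; apply: measurable_proj_dist.
  exact: estimator_measurable.
have csn : c * s != 0 by rewrite mulf_neq0// gt_eqF.
have count x : \sum_w \1_(G w) x <= #|W|%:R * (3 / 4 : R) ^+ (K * b).
  have [H [H1 H2]] := hU ((c * s)^-1 *: dlsubmx (Vhat i0 x *m (Vhat i0 x)^T)).
  apply: le_trans (fano_count cW H2); apply: ler_sum => w _; rewrite indicE ler_nat.
  case: (boolP (x \in G w)) => // /set_mem; rewrite /G/= => xG.
  rewrite lt0b; have h1 := frame_loss (U w) (Vhat i0 x) csn.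
  have h2 : proj_dist (Vhat i0 x) (Vw w) ^+ 2 < t ^+ 2.
    by rewrite ltr_pXn2r// ?nnegrE ?frobenius_norm_ge0// ltW.
  (* A loss below [t] puts the rescaled block within K / 8 of [U w] in squared norm, hence 8 H w < K
     b, the threshold of [fano_count]. *)
  have h3 := lt_le_trans (le_lt_trans h1 h2) t_le.
  have cs2 : 0 < (c * s) ^+ 2 by rewrite exprn_even_gt0.
  rewrite ltr_pM2l// in h3.
  have := le_lt_trans (H1 w) h3; rewrite ltr_pdivrMr ?ltr0n// => h4.
  rewrite -(ler_nat R) !natrM; lra.
have l0 : 0 < (K * b)%:R / 8 :> R.
  by rewrite divr_gt0// ltr0n (leq_trans _ Kb64).
have [w hw] := fano D W0 l0 mG count.
exists (P w), [set: 'I_m]%SET, (Vs w); split.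
  apply: in_model_tprod => //.
  - move=> i j _ _; rewrite /Vs.
    have dl : proj_dist (Vw w) V0 <= delta \/ I0 = [set: 'I_m]%SET.
      case: close => [->|h]; [by right|left].
      by rewrite -(ler_pXn2r (n:=2))// ?nnegrE ?frobenius_norm_ge0// dV.
    case: ifPn => iI; case: ifPn => jI; rewrite ?proj_dist_self//.
      by case: dl => // E; rewrite E inE in jI.
    by case: dl => [|E]; [rewrite proj_distC|rewrite E inE in iI].
  - by rewrite finset.setCT cards0 mulr_ge0.
have mL := measurable_superlevel t (measurable_max_loss [set: 'I_m]%SET (Vs w)
  (estimator_measurable eV)).
apply: (@le_trans _ _ (P w (~` G w))); last first.
  apply: le_measure; rewrite ?inE; [exact: measurableC|exact: mL|].
  move=> x /= /negP; rewrite -leNgt => h; apply: le_trans h _.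
  have := @proj_dist_le_max_loss R m (K + p) K [set: 'I_m]%SET
    (fun i => Vhat i x) (Vs w) i0 (finset.in_setT _).
  by rewrite {1}/Vs i0I0.
rewrite probability_setC//.
have := le_trans hw (_ : _ <= (1 / 2)%:E)%E.
rewrite lee_fin => /(_ (fano_numeric Kb64 kappa_le)).
have -> : P w (G w) = (fine (P w (G w)))%:E by rewrite fineK// fin_num_measure.
by rewrite -EFinB !lee_fin; lra.
Qed.

End fano_risk.

(** * Contamination *)

Section random_subset.
Context {R : realType}.
Variables (m : nat) (e : R).

(** The probability that [S] is the set of clean sources when each source is contaminated
    independently with probability [e]. *)
Definition subset_weight (S : {set 'I_m}) : R :=
  \prod_(i < m) (if i \in S then 1 - e else e).

Lemma sum_subset_prod (f g : 'I_m -> R) :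
  \sum_S subset_weight S * \prod_i (if i \in S then f i else g i) =
  \prod_i ((1 - e) * f i + e * g i).
Proof.
rewrite bigA_distr; apply: eq_bigr => S _.
by rewrite -big_split; apply: eq_bigr => i _ /=; case: ifP.
Qed.

Lemma sum_subset_weight : \sum_S subset_weight S = 1.
Proof.
have := sum_subset_prod (fun _ => 1) (fun _ => 1).
rewrite [X in _ = X -> _]big1; last by move=> i _; ring.
move=> <-; apply: eq_bigr => S _; rewrite big1 ?mulr1// => i _; by case: ifP.
Qed.

Lemma subset_weight_ge0 S : 0 <= e -> e <= 1 -> 0 <= subset_weight S.
Proof.
by move=> e0 e1; apply: prodr_ge0 => i _; case: ifP => _ //; rewrite subr_ge0.
Qed.

Lemma mean_card_setC :
  \sum_S subset_weight S * #|(~: S)%SET|%:R = m%:R * e.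
Proof.
have h (i : 'I_m) : \sum_S subset_weight S * (i \notin S)%:R = e.
  (* The factor at [i] vanishes exactly when [i] is in [S], so the product over j is the indicator
     of [i \notin S]. *)
  have := sum_subset_prod (fun j => (j != i)%:R) (fun _ => 1).
  rewrite [X in _ = X -> _](bigD1 i)//= eqxx mulr0 add0r mulr1.
  rewrite [X in _ = _ * X -> _]big1; last by move=> j -> /=; rewrite !mulr1 subrK.
  rewrite mulr1 => <-; apply: eq_bigr => S _; congr (_ * _).
  rewrite (bigD1 i)//= eqxx big1 ?mulr1; last by move=> j ->; case: ifP.
  by case: (i \in S).
transitivity (\sum_(i < m) \sum_S subset_weight S * (i \notin S)%:R).
  rewrite exchange_big; apply: eq_bigr => S _; rewrite -mulr_sumr; congr (_ * _).
  rewrite -natr_sum -sum1_card big_mkcond; congr (_%:R); apply: eq_bigr => i _.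
  by rewrite finset.in_setC; case: (i \in S).
by under eq_bigr do rewrite h; rewrite sumr_const card_ord -[LHS]mulr_natl.
Qed.

Lemma large_setC_weight (r : R) : 0 <= e -> e <= 1 -> 0 < r ->
  \sum_(S : {set 'I_m} | ~~ (#|(~: S)%SET|%:R <= r)) subset_weight S <= m%:R * e / r.
Proof.
move=> e0 e1 r0; rewrite ler_pdivlMr// mulr_suml -mean_card_setC.
rewrite [leRHS](bigID (fun S : {set 'I_m} => #|(~: S)%SET|%:R <= r))/=.
rewrite ler_wpDl//; first by apply: sumr_ge0 => S _; rewrite mulr_ge0// subset_weight_ge0.
apply: ler_sum => S; rewrite -ltNge => /ltW h.
by rewrite ler_wpM2l// subset_weight_ge0.
Qed.

End random_subset.

Section sum_measure.
Local Open Scope classical_set_scope.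
Context d (T : measurableType d) (R : realType).

(** Turns a finite mixture into a measure, as uniqueness on boxes demands. *)
Lemma ex_sum_measure (I : Type) (s : seq I) (w : I -> R)
    (mu : I -> {measure set T -> \bar R}) :
  (forall i, 0 <= w i) ->
  exists M : {measure set T -> \bar R},
    forall A, (M A = \sum_(i <- s) (w i)%:E * mu i A)%E.
Proof.
move=> w0; elim: s => [|i s [M hM]].
  by exists mzero => A; rewrite big_nil.
exists (measure_add (mscale (NngNum (w0 i)) (mu i)) M) => A.
rewrite big_cons -hM; exact: measure_addE.
Qed.

End sum_measure.

Section mixture.
Local Open Scope classical_set_scope.
Context d (T : measurableType d) (R : realType).
Variables (m : nat) (e : R) (mu0 nu0 mu1 nu1 : probability T R).
Hypotheses (e0 : 0 <= e) (e1 : e <= 1).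
Hypothesis mix01 : forall A, measurable A ->
  ((1 - e)%:E * mu0 A + e%:E * nu0 A = (1 - e)%:E * mu1 A + e%:E * nu1 A)%E.

Definition contaminated (mu nu : probability T R) (S : {set 'I_m}) :
    probability (m.-tuple T) R :=
  tprod (fun i => if i \in S then mu else nu).

(** Averaged over [S], the sources become independent, each with law (1 - e) mu + e nu: the mixture
    depends on [mu] and [nu] through this combination only. *)
Lemma mixture_box (mu nu : probability T R) (A : 'I_m -> set T) :
  (forall i, measurable (A i)) ->
  (\sum_S (subset_weight e S)%:E * contaminated mu nu S (box A) =
   \prod_(i < m) ((1 - e)%:E * mu (A i) + e%:E * nu (A i)))%E.
Proof.
move=> mA; pose f i := fine (mu (A i)); pose g i := fine (nu (A i)).
have fE i : mu (A i) = (f i)%:E by rewrite fineK// fin_num_measure.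
have gE i : nu (A i) = (g i)%:E by rewrite fineK// fin_num_measure.
under [RHS]eq_bigr do rewrite fE gE -!EFinM -EFinD.
rewrite prodEFin -sum_subset_prod -sumEFin; apply: eq_bigr => S _.
rewrite EFinM; congr (_ * _)%E; rewrite /contaminated tprod_box// -prodEFin.
by apply: eq_bigr => i _; case: ifP => _; rewrite ?fE ?gE.
Qed.

Lemma mixture_eq (B : set (m.-tuple T)) : measurable B ->
  (\sum_S (subset_weight e S)%:E * contaminated mu0 nu0 S B =
   \sum_S (subset_weight e S)%:E * contaminated mu1 nu1 S B)%E.
Proof.
have w0 S := @subset_weight_ge0 R m e S e0 e1.
have [M0 M0E] := ex_sum_measure (index_enum {set 'I_m})
   (fun S => contaminated mu0 nu0 S : {measure set _ -> \bar R}) w0.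
have [M1 M1E] := ex_sum_measure (index_enum {set 'I_m})
   (fun S => contaminated mu1 nu1 S : {measure set _ -> \bar R}) w0.
move=> mB; rewrite -M0E -M1E; apply: tuple_measure_unique => //.
  rewrite M0E; apply: (@le_lt_trans _ _ 1%E); last exact: ltry.
  rewrite -(@sum_subset_weight R m e) -sumEFin; apply: lee_sum => S _.
  by rewrite -[leRHS]mule1 lee_wpmul2l ?lee_fin// probability_le1.
move=> A mA; rewrite M0E M1E [LHS](mixture_box mu0 nu0 mA) [RHS](mixture_box mu1 nu1 mA).
by apply: eq_bigr => i _; exact: mix01.
Qed.

End mixture.

Section contaminated_testing.
Local Open Scope classical_set_scope.
Context d (T : measurableType d) (R : realType).
Variables (m : nat) (e : R) (mu nu : bool -> probability T R).
Hypotheses (e0 : 0 <= e) (e1 : e <= 1).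
Hypothesis mix : forall A, measurable A ->
  ((1 - e)%:E * mu true A + e%:E * nu true A =
   (1 - e)%:E * mu false A + e%:E * nu false A)%E.

(** Under the common mixture one of the two covering events has probability at least 1/2. Subsets
    with more than [r] contaminated sources account for at most 1/4 of it, so some single admissible
    [S] retains 1/4. *)
Lemma contaminated_testing (E : bool -> set (m.-tuple T)) (r : R) :
  (forall a, measurable (E a)) -> E true `|` E false = setT ->
  0 < r -> m%:R * e / r <= 1 / 4 ->
  exists (a : bool) (S : {set 'I_m}), #|(~: S)%SET|%:R <= r /\
    ((1 / 4)%:E <= contaminated (mu a) (nu a) S (E a))%E.
Proof.
move=> mE ET r0 hr.
have w0 S := @subset_weight_ge0 R m e S e0 e1.
pose q a (S : {set 'I_m}) B := fine (contaminated (mu a) (nu a) S B).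
have qE a S B : measurable B -> contaminated (mu a) (nu a) S B = (q a S B)%:E.
  by move=> mB; rewrite /q fineK// fin_num_measure.
have q1 a S B : measurable B -> q a S B <= 1.
  by move=> mB; rewrite -lee_fin -qE// probability_le1.
have mixE B : measurable B ->
    \sum_S subset_weight e S * q true S B = \sum_S subset_weight e S * q false S B.
  move=> mB; apply: EFin_inj; rewrite -!sumEFin.
  apply: (etrans _ (etrans (mixture_eq e0 e1 mix mB) _)); apply: eq_bigr => S _.
    by rewrite EFinM qE.
  by rewrite EFinM qE.
have [a ha] : exists a, 1 / 2 <= \sum_S subset_weight e S * q a S (E a).
  apply: contrapT => /forallNP hn.
  have hlt a : \sum_S subset_weight e S * q a S (E a) < 1 / 2 by rewrite ltNge; apply/negP.
  have : \sum_(S : {set 'I_m}) subset_weight e S <=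
      \sum_S subset_weight e S * (q true S (E true) + q true S (E false)).
    apply: ler_sum => S _; rewrite -[leLHS]mulr1 ler_wpM2l//.
    rewrite -lee_fin EFinD -qE// -qE//.
    apply: le_trans (measureU2 _ (mE true) (mE false)); rewrite ET.
    by rewrite le_eqVlt; apply/orP; left; apply/eqP/esym; exact: probability_setT.
  have -> : \sum_S subset_weight e S * (q true S (E true) + q true S (E false)) =
      \sum_S subset_weight e S * q true S (E true) + \sum_S subset_weight e S * q true S (E false).
    by rewrite -big_split; apply: eq_bigr => S _; rewrite mulrDr.
  rewrite (mixE (E false))// sum_subset_weight.
  have := ltrD (hlt true) (hlt false); rewrite -splitr => h1 h2.
  by have := le_lt_trans h2 h1; rewrite ltxx.
pose good (S : {set 'I_m}) := #|(~: S)%SET|%:R <= r.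
have hbad : \sum_(S | ~~ good S) subset_weight e S <= 1 / 4.
  exact: le_trans (large_setC_weight m e0 e1 r0) hr.
have [S gS hS] : exists2 S, good S & 1 / 4 <= q a S (E a).
  apply: contrapT => hn.
  have hlt S : good S -> q a S (E a) <= 1 / 4.
    by move=> gS; rewrite leNgt; apply/negP => /ltW h; apply: hn; exists S.
  have h1 : \sum_S subset_weight e S * q a S (E a) <=
      (\sum_(S | good S) subset_weight e S) * (1 / 4) +
      \sum_(S | ~~ good S) subset_weight e S.
    rewrite (bigID good)/= mulr_suml.
    apply: lerD; first by apply: ler_sum => S gS; rewrite ler_wpM2l// hlt.
    by apply: ler_sum => S _; rewrite ler_piMr// q1.
  have h2 := sum_subset_weight m e; rewrite (bigID good)/= in h2.
  have h3 : 0 <= \sum_(S | ~~ good S) subset_weight e S by apply: sumr_ge0.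
  have h4 := le_trans ha h1; move: hbad h2 h3 h4.
  move: (\sum_(S | good S) _) (\sum_(S | ~~ good S) _) => A B.
  clear ET; lra.
by exists a, S; split => //; rewrite qE// lee_fin.
Qed.

End contaminated_testing.

Section contamination_risk.
Local Open Scope classical_set_scope.
Context {R : realType}.
Variables (n m K p : nat) (delta eps sigma c s t : R) (U : 'M[R]_(p, K)).
Hypotheses (m0 : (0 < m)%N) (oU : orthonormal_columns U).
Hypotheses (sigma0 : 0 <= sigma) (delta0 : 0 <= delta) (eps0 : 0 < eps) (eps1 : eps <= 1 / 2).
Hypotheses (cs : c ^+ 2 + s ^+ 2 = 1).
Hypothesis kappa_le : n%:R *
  (3 / 2 * (sigma ^+ 2 / (sigma + 1)) * (8 * K%:R * (c * s) ^+ 2)) <= (eps / 8) ^+ 2.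
Hypotheses (t0 : 0 < t) (t_le : t ^+ 2 <= 2 * K%:R * (c * s) ^+ 2).

Let Va (a : bool) := frame c (if a then s else - s) U.

Let oVa a : orthonormal_columns (Va a).
Proof. by apply: frame_orthonormal => //; case: a; rewrite ?sqrrN. Qed.

Let dist_Va : proj_dist (Va true) (Va false) ^+ 2 = 8 * K%:R * (c * s) ^+ 2.
Proof.
rewrite /Va frame_dist ?sqrrN//.
have -> : 8 * K%:R * (c * s) ^+ 2 =
  2 * K%:R * ((c ^+ 2 + s ^+ 2) ^+ 2 - (c * c + s * - s) ^+ 2) by ring.
by rewrite cs expr1n.
Qed.

(** The loss counts clean sources only, while [S] is known only after the averaging. The event [E a]
    therefore asks for a large error on at least half of the sources, more than can be
    contaminated. *)
Lemma contamination_risk : ((1 / 4)%:E <= minimax_risk n m (K + p) K delta eps sigma t)%E.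
Proof.
pose e := eps / 8.
have e0 : 0 < e by rewrite divr_gt0.
have e1 : e <= 1 by have := eps1; rewrite /e; lra.
have D : llr_data (obs_law n sigma (Va true)) (obs_law n sigma (Va false)) (e ^+ 2).
  apply: (@llr_mono _ _ _ _ _ (\sum_(j < n)
    3 / 2 * (sigma ^+ 2 / (sigma + 1)) * proj_dist (Va true) (Va false) ^+ 2)).
    by rewrite sumr_const card_ord -[leLHS]mulr_natl dist_Va.
  by apply: llr_tprod => j; exact: llr_spiked.
have [Q1 [Q0 mix]] := llr_contamination D e0 e1 (lexx _).
pose Pa a := obs_law n sigma (Va a).
pose Qa (a : bool) := if a then Q1 else Q0.
pose P a S : probability (sample R n m (K + p)) R := contaminated (Pa a) (Qa a) S.
apply: le_minimax_risk => Vhat eV.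
pose L a i := [set x : sample R n m (K + p) | t <= proj_dist (Vhat i x) (Va a)].
have mL a i : measurable (L a i).
  apply: measurable_superlevel; apply: measurable_proj_dist.
  exact: estimator_measurable.
pose E a := [set x | m%:R / 2 <= \sum_(i < m) (\1_(L a i) x : R)].
have mE a : measurable (E a).
  by apply: measurable_superlevel; apply: measurable_sum => i; exact: measurable_indic.
(* The two subspaces are at distance at least 2 t, so on every source at least one of the two errors
   reaches [t]; one of the two counts is then at least m / 2. *)
have ELL x : E true x \/ E false x.
  have [h1|h1] := leP (m%:R / 2) (\sum_(i < m) (\1_(L true i) x : R)); first by left.
  right; rewrite /E/= leNgt; apply/negP => h2.
  have : \sum_(i < m) (1 : R) <= \sum_(i < m) (\1_(L true i) x + \1_(L false i) x).
    apply: ler_sum => i _; rewrite !indicE.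
    have [h|h3] := leP t (proj_dist (Vhat i x) (Va true)).
      by rewrite (mem_set (h : L true i x)) lerDl.
    have [h|h4] := leP t (proj_dist (Vhat i x) (Va false)).
      by rewrite (mem_set (h : L false i x)) lerDr.
    exfalso.
    have h5 a : proj_dist (Vhat i x) (Va a) < t -> proj_dist (Vhat i x) (Va a) ^+ 2 < t ^+ 2.
      by move=> h; rewrite ltr_pXn2r// ?nnegrE ?frobenius_norm_ge0// ltW.
    have := frobenius_parallelogram (Va true *m (Va true)^T) (Va false *m (Va false)^T)
      (Vhat i x *m (Vhat i x)^T).
    rewrite -/(proj_dist (Va true) (Va false)) -/(proj_dist (Vhat i x) (Va true)).
    rewrite -/(proj_dist (Vhat i x) (Va false)) dist_Va.
    have := h5 _ h3; have := h5 _ h4; have := t_le; lra.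
  have -> : \sum_(i < m) (\1_(L true i) x + \1_(L false i) x) =
      \sum_(i < m) (\1_(L true i) x : R) + \sum_(i < m) (\1_(L false i) x : R).
    by rewrite big_split.
  rewrite sumr_const card_ord => h3.
  by have := le_lt_trans h3 (ltrD h1 h2); rewrite -splitr ltxx.
have mR : 0 < m%:R :> R by rewrite ltr0n.
(* With e = eps / 8 this makes Markov's bound m e / r equal to 1/4, and r <= m / 4 stays strictly
   below the m / 2 errors counted by [E a], even when eps = 1/2. *)
pose r := eps / 2 * m%:R.
have r0 : 0 < r by rewrite mulr_gt0// divr_gt0.
have hr : m%:R * e / r <= 1 / 4 by rewrite ler_pdivrMr// /e /r; lra.
have ET : E true `|` E false = setT.
  by apply/seteqP; split => // x _; exact: ELL.
have [a [S [gS hS]]] := contaminated_testing (mu := Pa) (nu := Qa) (ltW e0) e1 mix mE ET r0 hr.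
exists (P a S), S, (fun _ => Va a); split.
  apply: in_model_tprod => //.
  - by move=> i iS; rewrite iS.
  - by move=> i j _ _; rewrite proj_dist_self.
  - apply: le_trans gS _; rewrite /r ler_wpM2r//; have := eps0; lra.
apply: (@le_trans _ _ (P a S (E a))); first exact: hS.
apply: le_measure; rewrite ?inE; [exact: mE| |].
  apply: measurable_superlevel; apply: measurable_max_loss.
  exact: estimator_measurable.
move=> x Ex /=.
suff [i iS iL] : exists2 i, i \in S & L a i x.
  apply: le_trans iL _.
  exact: (@proj_dist_le_max_loss R m (K + p) K S (fun i => Vhat i x) (fun _ => Va a) i iS).
apply: contrapT => hn.
have : \sum_(i < m) (\1_(L a i) x : R) <= \sum_(i < m) (i \in (~: S)%SET)%:R.
  apply: ler_sum => i _; rewrite indicE finset.in_setC.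
  case: (boolP (i \in S)) => iS /=; last by case: (x \in L a i).
  by rewrite memNset// => iL; apply: hn; exists i.
have -> : \sum_(i < m) ((i \in (~: S)%SET)%:R : R) = #|(~: S)%SET|%:R.
  rewrite -natr_sum -sum1_card [in RHS]big_mkcond; congr (_%:R).
have := Ex; rewrite /E/= => h1 h2; have := le_trans (le_trans h1 h2) gS.
by rewrite /r; have := eps1; nra.
Qed.

End contamination_risk.

(** * The lower bound *)

(** [p.+1 - K] is the longest sign vector that [packing] allows; d >= 128 K makes it at least 64 and
    comparable with d = K + p. *)
Lemma block_size (K p : nat) : (0 < K)%N -> (128 * K <= K + p)%N ->
  [/\ (0 < p.+1 - K)%N, (K + (p.+1 - K) <= p.+1)%N, (64 <= p.+1 - K)%N, (K <= p)%N &
      (K + p <= 2 * (p.+1 - K))%N /\ (p.+1 - K <= K + p)%N].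
Proof. by move=> K0 Kp; split; [..|split]; lia. Qed.

Lemma max_of_three (disp : Order.disp_t) (T : orderType disp) (x y z : T) :
  [\/ (y <= x)%O /\ (z <= x)%O, (x <= y)%O /\ (z <= y)%O | (x <= z)%O /\ (y <= z)%O].
Proof.
have [yx|/ltW xy] := leP y x; have [zx|/ltW xz] := leP z x.
- exact: Or31.
- by apply: Or33; split => //; exact: le_trans xz.
- by apply: Or32; split => //; exact: le_trans xy.
- by have [zy|/ltW yz] := leP z y; [exact: Or32|exact: Or33].
Qed.

Section terms.
Context {R : realType}.

(** Here [s2] is s^2. As c^2 = 1 - s2 >= 1/2, the radius allowed by [fano_risk] is at least K s2 /
    16 squared, which is 400 K s2 / 80^2. *)
Lemma fano_term (n m K p : nat) (delta eps sigma T s2 : R) (i0 : 'I_m) (I0 : {set 'I_m}) :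
  (0 < K)%N -> (128 * K <= K + p)%N -> 0 <= sigma -> 0 <= delta -> 0 <= eps ->
  i0 \in I0 -> 0 < s2 -> s2 <= 1 / 2 ->
  (#|I0| * n)%:R * (3 * (sigma ^+ 2 / (sigma + 1)) * s2) <= (p.+1 - K)%:R / 64 ->
  I0 = [set: 'I_m]%SET \/ 2 * K%:R * s2 <= delta ^+ 2 ->
  0 < T -> T ^+ 2 <= 400 * K%:R * s2 ->
  ((1 / 2)%:E <= minimax_risk n m (K + p) K delta eps sigma (T / 80))%E.
Proof.
move=> K0 Kp sigma0 delta0 eps0 i0I s20 s2h kappa_le close T0 TK.
have [b0 Kb b64 _ _] := block_size K0 Kp.
have s2E : Num.sqrt s2 ^+ 2 = s2 by rewrite sqr_sqrtr// ltW.
have c2E : Num.sqrt (1 - s2) ^+ 2 = 1 - s2 by rewrite sqr_sqrtr//; lra.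
have K0R : 0 <= K%:R :> R by [].
apply: (@fano_risk R n m K p (p.+1 - K)%N delta eps sigma
  (Num.sqrt (1 - s2)) (Num.sqrt s2) _ i0 I0) => //.
- by apply: leq_trans b64 _; rewrite leq_pmull.
- by rewrite sqrtr_gt0; lra.
- by rewrite sqrtr_gt0.
- by rewrite s2E c2E subrK.
- rewrite s2E [in leRHS]natrM.
  have -> : (#|I0| * n)%:R * (3 / 2 * (sigma ^+ 2 / (sigma + 1)) * (2 * K%:R * s2)) =
    K%:R * ((#|I0| * n)%:R * (3 * (sigma ^+ 2 / (sigma + 1)) * s2)).
    by set v := _ / (sigma + 1); set N := (_ * n)%:R; field.
  rewrite -[leRHS]mulrA. exact: ler_wpM2l.
- by rewrite s2E.
- by rewrite divr_gt0.
- have h : 0 <= K%:R * s2 * (1 / 2 - s2) by rewrite !mulr_ge0// ?subr_ge0// ltW.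
  rewrite !exprMn c2E s2E exprVn; lra.
Qed.

(** As c^2 >= 1/2, the squared radius 2 K (c s)^2 of [contamination_risk] is at least K s2 = 6400 K
    s2 / 80^2; the same divisor 80 as in [fano_term] lets the three regimes share one constant. *)
Lemma contamination_term (n m K p : nat) (delta eps sigma T s2 : R) :
  (0 < m)%N -> (0 < K)%N -> (K <= p)%N -> 0 <= sigma -> 0 <= delta -> 0 < eps ->
  eps <= 1 / 2 -> 0 <= s2 -> s2 <= 1 / 2 ->
  n%:R * (12 * (sigma ^+ 2 / (sigma + 1)) * (K%:R * s2)) <= (eps / 8) ^+ 2 ->
  0 < T -> T ^+ 2 <= 6400 * K%:R * s2 ->
  ((1 / 4)%:E <= minimax_risk n m (K + p) K delta eps sigma (T / 80))%E.
Proof.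
move=> m0 K0 Kp sigma0 delta0 eps0 eps1 s20 s2h kappa_le T0 TK.
have s2E : Num.sqrt s2 ^+ 2 = s2 by rewrite sqr_sqrtr.
have c2E : Num.sqrt (1 - s2) ^+ 2 = 1 - s2 by rewrite sqr_sqrtr//; lra.
have [U [oU _]] := @ex_isometry_orthogonal R p 0 K (0 : 'M[R]_(p, 0)) Kp.
have K0R : 0 <= K%:R :> R by [].
apply: (@contamination_risk R n m K p delta eps sigma
  (Num.sqrt (1 - s2)) (Num.sqrt s2) _ U) => //.
- by rewrite s2E c2E subrK.
- apply: le_trans kappa_le; rewrite exprMn c2E s2E ler_wpM2l//.
  have v0 : 0 <= sigma ^+ 2 / (sigma + 1) by rewrite divr_ge0 ?sqr_ge0 ?addr_ge0.
  have -> : 3 / 2 * (sigma ^+ 2 / (sigma + 1)) * (8 * K%:R * ((1 - s2) * s2)) =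
    12 * (sigma ^+ 2 / (sigma + 1)) * (K%:R * s2 * (1 - s2)).
    by set v := _ / (sigma + 1); field.
  apply: ler_wpM2l; first exact: mulr_ge0.
  have h : 0 <= K%:R * s2 * s2 by rewrite !mulr_ge0.
  lra.
- by rewrite divr_gt0.
- have h : 0 <= K%:R * s2 * (1 / 2 - s2) by rewrite !mulr_ge0// subr_ge0.
  rewrite !exprMn c2E s2E exprVn; lra.
Qed.

End terms.

Theorem theorem4p2 (R : realType) :
  exists C1 C2 C3 C4 : R,
    [/\ 0 < C1, 0 < C2, 0 < C3 & 0 < C4] /\
    forall (n m d K : nat) (delta eps sigma : R),
      (0 < n)%N -> (0 < m)%N -> (0 < d)%N -> (0 < K)%N ->
      0 <= delta -> 0 < sigma ->
      0 <= eps -> eps <= 1 / 2 ->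
      K%:R <= d%:R / C1 ->
      (sigma + 1) / sigma ^+ 2 * (d%:R / n%:R) <= C2 ->
      (C4%:E <=
        minimax_risk n m d K delta eps sigma
          (C3 * (Num.sqrt ((sigma + 1) * K%:R * d%:R
                             / (sigma ^+ 2 * n%:R * m%:R))
                 + Num.min delta
                     (Num.sqrt ((sigma + 1) * K%:R * d%:R
                                  / (sigma ^+ 2 * n%:R)))
                 + eps * Num.sqrt ((sigma + 1) / (sigma ^+ 2 * n%:R)))))%E.
Proof.
(* 128 is what [block_size] requires; the bound 1 keeps every [s2] below 1/2; 240 is 3 times 80,
   since the sum is at most three times its largest term; 1/4 is the smaller of the probabilities
   1/2 and 1/4 obtained. *)
exists 128, 1, (1 / 240), (1 / 4); split; first by split; lra.
move=> n m d K delta eps sigma n0 m0 d0 K0 delta0 sigma0 eps0 eps1 Kd snr.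
have nR : 0 < n%:R :> R by rewrite ltr0n.
have mR : 1 <= m%:R :> R by rewrite ler1n.
have KR : 1 <= K%:R :> R by rewrite ler1n.
have dR : 1 <= d%:R :> R by rewrite ler1n.
have Kd' : (128 * K <= d)%N.
  by move: Kd; rewrite ler_pdivlMr// -natrM ler_nat mulnC.
have [p dE] : exists p, d = (K + p)%N.
  by exists (d - K)%N; rewrite subnKC// (leq_trans _ Kd')// leq_pmull.
have Kd2 := Kd'; rewrite dE in Kd2.
have [_ _ _ Kp [dbN bdN]] := block_size K0 Kd2.
pose A := (sigma + 1) / (sigma ^+ 2 * n%:R).
have A0 : 0 < A by rewrite divr_gt0 ?mulr_gt0 ?exprn_gt0//; lra.
have Ad : A * d%:R <= 1.
  by apply: le_trans snr; rewrite /A le_eqVlt; apply/orP; left; apply/eqP; field; rewrite !gt_eqF.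
pose v := sigma ^+ 2 / (sigma + 1).
have v0 : 0 < v by rewrite divr_gt0 ?exprn_gt0//; lra.
(* Up to a constant, [n v] is the divergence that one source yields per unit of squared distance, so
   [A] is the squared resolution of one source. *)
have nvA : n%:R * v * A = 1 by rewrite /v /A; field; rewrite !gt_eqF//; lra.
have T1E : (sigma + 1) * K%:R * d%:R / (sigma ^+ 2 * n%:R * m%:R) = A * K%:R * d%:R / m%:R.
  by rewrite /A; field; rewrite !gt_eqF//; lra.
have T2E : (sigma + 1) * K%:R * d%:R / (sigma ^+ 2 * n%:R) = A * K%:R * d%:R.
  by rewrite /A; field; rewrite !gt_eqF.
rewrite T1E T2E -/A.
clearbody A.
have m0R : 0 < m%:R :> R by rewrite ltr0n.
have K0R : 0 < K%:R :> R by rewrite ltr0n.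
have d0R : 0 < d%:R :> R by rewrite ltr0n.
have Q0 : 0 < A * K%:R * d%:R / m%:R by rewrite divr_gt0 ?mulr_gt0.
set T1 := Num.sqrt (_ / m%:R); set T2 := Num.min _ _; set T3 := eps * _.
have T1sq : T1 ^+ 2 = A * K%:R * d%:R / m%:R.
  by rewrite sqr_sqrtr// ltW.
have T10 : 0 < T1 by rewrite sqrtr_gt0.
pose b : R := (p.+1 - K)%:R.
have bd : d%:R <= 2 * b by rewrite /b -natrM ler_nat dE.
have bd' : b <= d%:R by rewrite /b ler_nat dE.
have Ab : A * b <= 1 by apply: le_trans Ad; rewrite ler_pM2l.
have b0 : 0 < b by lra.
have A1 : A <= 1 by apply: le_trans Ad; rewrite ler_peMr// ltW.
have AKdb : A * K%:R * d%:R <= 400 * K%:R * (b * A / 192).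
  have h : 0 <= A * K%:R * (2 * b - d%:R) by rewrite !mulr_ge0 ?subr_ge0// ltW.
  have h' : 0 <= A * K%:R * b by rewrite !mulr_ge0// ltW.
  lra.
pose i0 := Ordinal m0.
have sigma0' := ltW sigma0.
have reduce (T c : R) : T1 <= T -> T2 <= T -> T3 <= T -> 1 / 4 <= c ->
    (c%:E <= minimax_risk n m d K delta eps sigma (T / 80))%E ->
    ((1 / 4)%:E <= minimax_risk n m d K delta eps sigma (1 / 240 * (T1 + T2 + T3)))%E.
  move=> h1 h2 h3 hc; move/le_trans; move/(_ _ (minimax_risk_anti _ _ _ _ _ _ _ _)) => h.
  by apply: le_trans (h _ _); rewrite ?lee_fin//; lra.
(* T1 is positive, hence so is the largest term; this yields delta > 0 and eps > 0 in the two cases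
   that rely on them. *)
have [[T21 T31]|[T12 T32]|[T13 T23]] := max_of_three T1 T2 T3.
- apply: (reduce T1 (1 / 2)) => //; first lra.
  (* This [s2] spends the divergence budget of [fano_term] exactly when all [m n] rows are
     informative; 192 is 3 times 64. *)
  have s2b : b * A / (192 * m%:R) <= 1 / 2.
    rewrite ler_pdivrMr; last lra.
    lra.
  rewrite dE; apply: (@fano_term R n m K p delta eps sigma T1
    (b * A / (192 * m%:R)) i0 [set: 'I_m]%SET) => //.
  + by rewrite finset.in_setT.
  + by rewrite divr_gt0 ?mulr_gt0.
  + rewrite cardsT card_ord natrM -/b -/v le_eqVlt; apply/orP; left; apply/eqP.
    have -> : b / 64 = b * (n%:R * v * A) / 64 by rewrite nvA mulr1.
    by field; rewrite gt_eqF.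
  + by left.
  + have -> : b * A / (192 * m%:R) = b * A / 192 / m%:R by field; rewrite gt_eqF//; lra.
    rewrite T1sq mulrA ler_pM2r// invr_gt0; lra.
- have T20 : 0 < T2 by exact: lt_le_trans T12.
  have delta0' : 0 < delta by apply: lt_le_trans T20 _; rewrite /T2 ge_min lexx.
  have T2_ge0 := ltW T20.
  have T2d : T2 ^+ 2 <= delta ^+ 2.
    by rewrite ler_pXn2r// /T2 ge_min lexx.
  have T2A : T2 ^+ 2 <= A * K%:R * d%:R.
    rewrite -[leRHS]sqr_sqrtr; last by rewrite !mulr_ge0// ltW.
    by rewrite ler_pXn2r// ?nnegrE ?sqrtr_ge0// /T2 ge_min lexx orbT.
  apply: (reduce T2 (1 / 2)) => //; first lra.
  (* The first bound keeps the deviating source within [delta] of the others, the second is the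
     divergence budget of a single source. *)
  pose s2 := Num.min (delta ^+ 2 / (2 * K%:R)) (b * A / 192).
  have s2b : s2 <= b * A / 192 by rewrite /s2 ge_min lexx orbT.
  have s2d : s2 <= delta ^+ 2 / (2 * K%:R) by rewrite /s2 ge_min lexx.
  rewrite dE; apply: (@fano_term R n m K p delta eps sigma T2 s2 i0 [set i0]%SET) => //.
  + by rewrite inE.
  + by rewrite /s2 lt_min !divr_gt0 ?mulr_gt0 ?exprn_gt0//; lra.
  + lra.
  + rewrite cards1 mul1n -/b -/v.
    have -> : b / 64 = n%:R * (3 * v * (b * A / 192)).
      have -> : b / 64 = b * (n%:R * v * A) / 64 by rewrite nvA mulr1.
      by field.
    by rewrite ler_wpM2l// ler_wpM2l// mulr_ge0// ltW.
  + by right; rewrite mulrC -ler_pdivlMr// mulr_gt0.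
  + rewrite /s2 minEle; case: ifP => _; last exact: le_trans T2A AKdb.
    have -> : 400 * K%:R * (delta ^+ 2 / (2 * K%:R)) = 200 * delta ^+ 2.
      by field; rewrite gt_eqF//; lra.
    by apply: le_trans T2d _; have := sqr_ge0 delta; lra.
- have T30 : 0 < T3 by exact: lt_le_trans T13.
  have eps0' : 0 < eps.
    by rewrite lt0r eps0 andbT; apply: contraTneq T30 => e0; rewrite /T3 e0 mul0r ltxx.
  have T3sq : T3 ^+ 2 = eps ^+ 2 * A by rewrite exprMn sqr_sqrtr// ltW.
  have eps2 : eps ^+ 2 <= 1 by apply: exprn_ile1 => //; lra.
  have e2A : eps ^+ 2 * A <= 1 by exact: mulr_ile1 (sqr_ge0 _) (ltW A0) eps2 A1.
  have K768 : 0 < 768 * K%:R :> R by apply: mulr_gt0 K0R; rewrite ltr0n.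
  apply: (reduce T3 (1 / 4)) => //; clear reduce.
  clearbody T1 T2 T3 b.
  have e2A0 : 0 <= eps ^+ 2 * A by exact: mulr_ge0 (sqr_ge0 _) (ltW A0).
  (* 768 is 12 times 64, so that the divergence equals (eps / 8)^2. Dividing by K fixes the distance
     between the two subspaces at the order eps sqrt A, which is why neither K nor d appears in the
     third term. *)
  have [s2 s2E] : exists s2, s2 = eps ^+ 2 * A / (768 * K%:R).
    by exists (eps ^+ 2 * A / (768 * K%:R)).
  have KE : K%:R * s2 = eps ^+ 2 * A / 768 by rewrite s2E; field; rewrite gt_eqF.
  have s20 : 0 <= s2 by rewrite s2E; exact: divr_ge0 e2A0 (ltW K768).
  have s2h : s2 <= 1 / 2 by rewrite s2E ler_pdivrMr; [lra|exact: K768].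
  have kappa : n%:R * (12 * v * (K%:R * s2)) <= (eps / 8) ^+ 2.
    have -> : (eps / 8) ^+ 2 = eps ^+ 2 * (n%:R * v * A) / 64 by rewrite nvA; field.
    by rewrite KE le_eqVlt; apply/orP; left; apply/eqP; field.
  have T3K : T3 ^+ 2 <= 6400 * K%:R * s2 by rewrite -mulrA KE T3sq; lra.
  rewrite dE.
  exact: (contamination_term m0 K0 Kp sigma0' delta0 eps0' eps1 s20 s2h kappa T30 T3K).
Qed.
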